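(* (One-dimensional Lipschitz stability.) Let $0<\sigma_0<\sigma_1$ be constants and $\Sigma^0=\{\sigma\in L^\infty(0,1):\ \sigma_0\le\sigma\le\sigma_1\text{ a.e. in }(0,1)\}$. For any $\sigma,\widetilde{\sigma}\in\Sigma^0$, $$\|R_\sigma-R_{\widetilde{\sigma}}\|_*=\left\|\frac1{\widetilde{\sigma}}-\frac1\sigma\right\|_{L^\infty(0,1)},$$ and $$\sigma_1^{-2}\|\widetilde{\sigma}-\sigma\|_{L^\infty(0,1)}\le\|R_\sigma-R_{\widetilde{\sigma}}\|_*\le\sigma_0^{-2}\|\widetilde{\sigma}-\sigma\|_{L^\infty(0,1)}.$$
   Context: Let $H=\{u\in H^1(0,1):u(1)=0\}$ with norm $\|u_x\|_{L^2(0,1)}$, and $H'$ its dual. For $\sigma\in\Sigma^0$ and $f\in H'$, $R_\sigma f=u_\sigma\in H$ is the unique solution of $\int_0^1\sigma u_xv_x\,dx=\langle f,v\rangle$ for all $v\in H$, i.e. the variational solution of $-(\sigma u_x)_x=f$ in $(0,1)$, $u_x(0)=0$, $u(1)=0$. For $f\in L^2(0,1)$ one has $(R_\sigma f)_x(x)=-\frac1{\sigma(x)}\int_0^xf(t)\,dt$ a.e. in $(0,1)$. $W^{-1,1}(0,1)$ is the closure (completion) of $C_0^\infty(0,1)$ for the norm $\|f\|_{W^{-1,1}(0,1)}=\left\|\int_0^xf(t)\,dt\right\|_{L^1(0,1)}$. For $m\in L^\infty(0,1)$, $T_m:W^{-1,1}(0,1)\to L^1(0,1)$ is the bounded linear operator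 given by $T_mf(x)=m(x)\int_0^xf(t)\,dt$ (extended by continuity from $C_0^\infty(0,1)$), and $\|\cdot\|_{-1,1}$ is the operator norm in $\mathscr{B}(W^{-1,1}(0,1),L^1(0,1))$. The norm $\|\cdot\|_*$ on the resolvents is $\|R_\sigma\|_*=\|T_{1/\sigma}\|_{-1,1}$, and on differences (more generally, linear combinations) of resolvents it is the $\mathscr{B}(W^{-1,1}(0,1),L^1(0,1))$ norm of the corresponding operator $f\mapsto(R_\sigma f-R_{\widetilde\sigma}f)_x$, i.e. $\|R_\sigma-R_{\widetilde\sigma}\|_*=\|T_{1/\sigma}-T_{1/\widetilde\sigma}\|_{-1,1}$. *)

(* Defs.v *)
(* MathComp-Analysis, over an abstract R : realType. *)
From HB Require Import structures.
From mathcomp Require Import all_boot all_order all_algebra.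
From mathcomp Require Import all_classical all_reals all_analysis.

Set Implicit Arguments.
Unset Strict Implicit.
Unset Printing Implicit Defensive.

Import Order.TTheory GRing.Theory Num.Theory.
Import numFieldNormedType.Exports.

Local Open Scope classical_set_scope.
Local Open Scope ring_scope.

(* A function on (0,1) is a function R -> R considered up to equality almost
   everywhere for [leb01]; L^p(0,1) is [Lfun leb01 p], with norm 'N[leb01]_p. *)
Definition leb01 {R : realType} : {measure set (measurableTypeR R) -> \bar R} :=
  mrestr (@lebesgue_measure R) (measurable_itv `]0, 1[%R).

Section Resolvents.
Context {R : realType}.

Implicit Types (u v g phi f sigma : R -> R).

(* C_0^oo(0,1), each function being extended by 0 to R. *)
Definition testfun : set (R -> R) := [set phi |
  (forall n x, derivable (derive1n n phi) x 1) /\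
  (exists a b : R, [/\ 0 < a, b < 1 & forall x, ~ (a <= x <= b) -> phi x = 0])].

Definition weak_derivative u g : Prop := forall phi, testfun phi ->
  \int[leb01]_x (u x * derive1 phi x) = - \int[leb01]_x (g x * phi x).

(* The L^2 weak derivative u_x; it is unique up to a.e. equality, and junk if
   u is not in H^1(0,1). *)
Definition wderiv u : R -> R :=
  get [set g | g \in Lfun leb01 2%:E /\ weak_derivative u g].

Definition sobolevH1 : set (R -> R) := [set u | u \in Lfun leb01 2%:E /\
  exists g, g \in Lfun leb01 2%:E /\ weak_derivative u g].

(* u(1) = 0 is read on the continuous representative of u on [0,1]. *)
Definition sobolevH : set (R -> R) := [set u | sobolevH1 u /\
  exists U : R -> R, [/\ {within `[0, 1], continuous U},
    {ae leb01, forall x, u x = U x} & U 1 = 0]].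

Definition Sigma0 (sigma0 sigma1 : R) : set (R -> R) := [set sigma |
  sigma \in Lfun leb01 +oo%E /\
  {ae leb01, forall x, sigma0 <= sigma x <= sigma1}].

(* The dual H' of H, for the norm |u_x|_{L^2(0,1)} on H. *)
Definition dualH : set ((R -> R) -> R) := [set ell |
  (forall a u v, sobolevH u -> sobolevH v ->
    ell (fun x => a * u x + v x) = a * ell u + ell v) /\
  (exists C : R, forall v, sobolevH v ->
    (`|ell v|%:E <= C%:E * 'N[leb01]_(2%:E)[EFin \o wderiv v])%E)].

(* R_sigma ell in H, for ell in H'.  For sigma in Sigma0 the solution exists
   and is unique up to a.e. equality. *)
Definition resolvent sigma (ell : (R -> R) -> R) : R -> R :=
  get [set u | [/\ dualH ell, sobolevH u & forall v, sobolevH v ->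
    \int[leb01]_x (sigma x * wderiv u x * wderiv v x) = ell v]].

(* A function f seen as the functional v |-> <f, v>. *)
Definition pairing f : (R -> R) -> R := fun v => \int[leb01]_x (f x * v x).

(* The norm of W^{-1,1}(0,1) on C_0^oo(0,1). *)
Definition normW f : \bar R :=
  'N[leb01]_1[EFin \o (fun x => \int[lebesgue_measure]_(t in `[0, x]) f t)].

(* W^{-1,1}(0,1), the completion of C_0^oo(0,1) for [normW]: the set of the
   classes of Cauchy sequences modulo sequences tending to 0. *)
Definition cauchyW : set (nat -> R -> R) := [set s |
  (forall n, testfun (s n)) /\
  forall e : R, 0 < e -> exists N, forall m n, (N <= m)%N -> (N <= n)%N ->
    (normW (s m \- s n)%R < e%:E)%E].

Definition classW (s : nat -> R -> R) : set (nat -> R -> R) :=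
  [set s' | cauchyW s' /\ normW (s' n \- s n) @[n --> \oo] --> 0%E].

Definition W11 : set (set (nat -> R -> R)) := [set classW s | s in cauchyW].

Definition W11norm (w : set (nat -> R -> R)) : \bar R :=
  get [set r : \bar R | forall s, w s -> normW (s n) @[n --> \oo] --> r].

(* Extension by continuity to W^{-1,1}(0,1), with values in L^1(0,1), of an
   operator T given on C_0^oo(0,1). *)
Definition extW (T : (R -> R) -> R -> R) (w : set (nat -> R -> R)) : R -> R :=
  get [set g | g \in Lfun leb01 1%E /\ forall s, w s ->
    'N[leb01]_1[EFin \o (T (s n) \- g)%R]%E @[n --> \oo] --> 0%E].

(* The norm of B(W^{-1,1}(0,1), L^1(0,1)). *)
Definition opnormW (T : (R -> R) -> R -> R) : \bar R :=
  ereal_sup [set 'N[leb01]_1[EFin \o extW T w]%E |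
    w in [set w | W11 w /\ (W11norm w <= 1)%E]].

(* For A a linear combination of resolvents: the norm of f |-> (A f)_x. *)
Definition starnorm (A : ((R -> R) -> R) -> R -> R) : \bar R :=
  opnormW (fun f => wderiv (A (pairing f))).

End Resolvents.

(* Main.v *)
Require Import Defs.
From HB Require Import structures.
From mathcomp Require Import all_boot all_order all_algebra.
From mathcomp Require Import all_classical all_reals all_analysis.
From mathcomp Require Import measurable_realfun ess_sup_inf lra ring.
Import Order.TTheory GRing.Theory Num.Theory.
Import numFieldNormedType.Exports.
Local Open Scope classical_set_scope.
Local Open Scope ring_scope.

(** For a test function f put F x = int_0^x f.  An integration by parts against
    v in H, where v(1) = 0, gives <f, v> = - int F v_x, so that u = R_sigma f
    satisfies int (sigma u_x + F) v_x = 0 for every v in H.  As v_x runs through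
    all of L^2(0,1), u_x = - F / sigma a.e.  Hence f |-> (R_sigma f - R_sigmat f)_x
    is multiplication of F by m = 1/sigmat - 1/sigma ([wderiv_resolventB]), while
    the norm of f in W^{-1,1}(0,1) is the L^1 norm of F.

    The operator norm of such a multiplication is the L^oo norm of m
    ([opnormW_multiplication]).  It is at most this norm because the L^1 norm of
    m F is at most |m|_oo times that of F, and this passes to the completion.  It
    is at least this norm because F may be any nonnegative test function phi (take
    f = phi'): if c is the operator norm, then int (c - |m|) phi >= 0 for all these
    phi, whence |m| <= c a.e. ([fundamental_ge0]).  The two inequalities come from
    |1/sigmat - 1/sigma| = |sigmat - sigma| / (sigma sigmat), where
    sigma0^2 <= sigma sigmat <= sigma1^2.

    Three facts of analysis carry the first step.  An L^1 function with nonnegative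
    integral against every nonnegative test function is nonnegative a.e.
    ([fundamental_ge0], by Lebesgue differentiation); hence weak derivatives are
    unique.  The primitive of an L^1 function h has weak derivative h
    ([prim_weak_derivative], by Fubini).  The integration by parts in H, where f is
    smooth but F does not vanish near 1, is [sobolevH_parts]: F is corrected by a
    multiple of the primitive of a bump of mass 1 that moves towards 1. *)

(** * Smooth functions and bumps *)

Section Smooth.
Context {R : realType}.
Implicit Types (f g : R -> R) (x : R) (S : set (R -> R)).

Definition smooth : set (R -> R) := [set f |
  forall n x, derivable (derive1n n f) x 1].

(** Smoothness by coinduction: it is enough to exhibit a class of derivable functions
    that is closed under differentiation. *)
Lemma smooth_coind S : (forall f, S f -> (forall x, derivable f x 1) /\
  S (derive1 f)) -> S `<=` smooth.
Proof.
move=> hS f Sf n x.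
suff h : S (derive1n n f) by exact: (hS _ h).1.
by elim: n => [|n ih] //; rewrite derive1nS; exact: (hS _ ih).2.
Qed.

Lemma smooth_derivable f x : smooth f -> derivable f x 1.
Proof. by move=> /(_ 0%N x). Qed.

Lemma smooth_derive1 f : smooth f -> smooth (derive1 f).
Proof.
by move=> sf n x; have := sf n.+1 x; rewrite /derive1n iterSr.
Qed.

Lemma smooth_is_derive f x : smooth f -> is_derive x 1 f (derive1 f x).
Proof.
by move=> /smooth_derivable sf; rewrite derive1E; exact: derivableP.
Qed.

Lemma smooth_continuous f : smooth f -> continuous f.
Proof.
by move=> sf x; apply: differentiable_continuous; apply/derivable1_diffP;
  exact: smooth_derivable.
Qed.

Lemma smooth_measurable f : smooth f -> measurable_fun [set: R] f.
Proof. by move=> /smooth_continuous; exact: measurable_realfun.continuous_measurable_fun. Qed.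

(** By the sum and product rules this class is closed under differentiation, so
    that both closure properties of smooth functions come from a single use of
    [smooth_coind]. *)
Inductive smooth_alg : set (R -> R) :=
| smooth_algS f : smooth f -> smooth_alg f
| smooth_algD f g : smooth_alg f -> smooth_alg g -> smooth_alg (f + g)
| smooth_algM f g : smooth_alg f -> smooth_alg g -> smooth_alg (f * g).

Lemma smooth_algP : smooth_alg `<=` smooth.
Proof.
apply: smooth_coind => f; elim=> {f} [f sf|f g _ [df sf] _ [dg sg]|
    f g sf [df sf'] sg [dg sg']].
- split; first by move=> x; exact: smooth_derivable.
  by apply: smooth_algS; exact: smooth_derive1.
- split=> [x|]; first exact: derivableD.
  have -> : derive1 (f + g) = derive1 f + derive1 g.
    by apply/funext => x; rewrite !fctE !derive1E deriveD.
  exact: smooth_algD.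
- split=> [x|]; first exact: derivableM.
  have -> : derive1 (f * g) = f * derive1 g + g * derive1 f.
    by apply/funext => x; rewrite !fctE !derive1E deriveM.
  by apply: smooth_algD; exact: smooth_algM.
Qed.

Lemma smoothD f g : smooth f -> smooth g -> smooth (f + g).
Proof. by move=> sf sg; apply: smooth_algP; apply: smooth_algD; exact: smooth_algS. Qed.

Lemma smoothM f g : smooth f -> smooth g -> smooth (f * g).
Proof. by move=> sf sg; apply: smooth_algP; apply: smooth_algM; exact: smooth_algS. Qed.

Lemma smooth_cst (c : R) : smooth (cst c).
Proof.
apply: (@smooth_coind [set f | exists c, f = cst c]); last by exists c.
move=> _ [k ->]; split=> [x|]; first exact: derivable_cst.
by exists 0; apply/funext => x; rewrite derive1_cst.
Qed.

Lemma smoothZ (c : R) f : smooth f -> smooth (fun x => c * f x).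
Proof. by move=> sf; exact: smoothM (smooth_cst c) sf. Qed.

Lemma smoothB f g : smooth f -> smooth g -> smooth (f - g).
Proof.
move=> sf sg; have -> : f - g = f + cst (-1) * g.
  by apply/funext => x; rewrite !fctE /= mulN1r.
exact: smoothD sf (smoothM _ _ (smooth_cst _) sg).
Qed.

Lemma smooth_affine f (s c : R) : smooth f -> smooth (fun x => f (s * x + c)).
Proof.
move=> sf.
apply: (@smooth_coind [set h | exists k g, smooth g /\
    h = (fun x => k * g (s * x + c))]); last first.
  by exists 1, f; split => //; apply/funext => x; rewrite mul1r.
move=> _ [k [g [sg ->]]].
have dg x : is_derive x 1 (fun x => k * g (s * x + c))
    (k * s * derive1 g (s * x + c)).
  have da : is_derive x 1 (fun x : R => s * x + c) s.
    by apply: is_derive_eq; rewrite addr0 scaler1.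
  have dgx := @smooth_is_derive g (s * x + c) sg.
  have := @is_derive1_comp R g (fun x : R => s * x + c) x _ _ dgx da.
  move=> dgc; have := @is_deriveZ R R R _ k x 1 _ dgc.
  by move=> /is_derive_eq; apply; rewrite /GRing.scale/=; ring.
split=> [x|]; first by have [] := dg x.
exists (k * s), (derive1 g); split; first exact: smooth_derive1.
by apply/funext => x; rewrite derive1E; have [_ ->] := dg x.
Qed.

(** With a polynomial factor in 1/x, the family of the extensions by 0 of
    exp(-1/x) becomes closed under differentiation. *)
Definition flat (p : {poly R}) : R -> R :=
  fun x => if 0 < x then p.[x^-1] * expR (- x^-1) else 0.

Lemma flat_le0 p (x : R) : x <= 0 -> flat p x = 0.
Proof. by rewrite /flat leNgt => /negbTE ->. Qed.

Lemma flat1_gt0 (x : R) : 0 < x -> 0 < flat 1 x.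
Proof. by rewrite /flat => ->; rewrite hornerC mul1r expR_gt0. Qed.

Lemma flat1_ge0 (x : R) : 0 <= flat 1 x.
Proof. by have [/flat_le0->//|/flat1_gt0/ltW] := leP x 0. Qed.

Lemma flat1_lt1 (x : R) : flat 1 x < 1.
Proof.
have [/flat_le0->//|x0] := leP x 0.
by rewrite /flat x0 hornerC mul1r -expR0 ltr_expR oppr_lt0 invr_gt0.
Qed.

Lemma flat_derive_gt0 p (x : R) : 0 < x ->
  is_derive x 1 (flat p) (flat ((p - p^`()) * 'X^2) x).
Proof.
move=> x0.
have x0' : x != 0 by rewrite gt_eqF.
have dV : is_derive x 1 (@GRing.inv R) (- x ^- 2).
  by have := @is_deriveV R id x 1 1 x0' (is_derive_id _ _);
    move=> /is_derive_eq; apply; rewrite /GRing.scale/= mulr1.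
have dE : is_derive x 1 (fun x : R => expR (- x^-1)) (x^-2 * expR (- x^-1)).
  have dN : is_derive x 1 (fun x : R => - x^-1) (x^-2).
    by apply: is_derive_eq; rewrite opprK.
  have := @is_derive1_comp R expR (fun x : R => - x^-1) x _ _ (is_derive_expR _) dN.
  by move=> /is_derive_eq; apply; rewrite mulrC.
have dP : is_derive x 1 (fun x : R => p.[x^-1]) (- (p^`().[x^-1] * x^-2)).
  have := @is_derive1_comp R (horner p) (@GRing.inv R) x _ _ (is_derive_poly p _) dV.
  by move=> /is_derive_eq; apply; rewrite mulrN.
have := is_deriveM dP dE => dPE.
apply: (@near_eq_is_derive _ _ _ (fun x : R => p.[x^-1] * expR (- x^-1))).
  near=> y; rewrite /flat ifT//; near: y; exact: lt_nbhsr.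
apply: (is_derive_eq dPE).
rewrite /flat x0 !hornerE /GRing.scale/=.
by rewrite !expr2 !invfM; ring.
Unshelve. all: by end_near. Qed.

(** From y^(k+2) / (k+2)! <= exp y at y = 1/x, one monomial at a time; the power
    x^2 leaves a difference quotient at 0 that tends to 0. *)
Lemma flat_bound p : exists C, forall x : R, 0 < x <= 1 -> `|flat p x| <= C * x ^+ 2.
Proof.
elim/poly_ind: p => [|p c _].
  by exists 0 => x _; rewrite /flat horner0 mul0r if_same normr0 mul0r.
move: (p * 'X + c%:P) => {p c} q.
exists (\sum_(i < size q) `|q`_i| * ((i.+1).+1)`!%:R) => x /andP[x0 x1].
rewrite /flat x0 normrM (ger0_norm (expR_ge0 _)) horner_coef.
have h k : x^-1 ^+ k * expR (- x^-1) <= (k.+2)`!%:R * x ^+ 2.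
  have := @expR_ge1Dxn R x^-1 k.+1; rewrite invr_ge0 => /(_ (ltW x0)) hk.
  have {}hk : x^-1 ^+ k.+2 / (k.+2)`!%:R <= expR x^-1.
    by apply: le_trans hk; rewrite lerDr.
  rewrite expRN ler_pdivrMr ?expR_gt0//.
  have f0 : 0 < (k.+2)`!%:R :> R by rewrite ltr0n fact_gt0.
  rewrite ler_pdivrMr// in hk.
  have := ler_wpM2l (exprn_ge0 2 (ltW x0)) hk.
  have -> : x ^+ 2 * x^-1 ^+ k.+2 = x^-1 ^+ k.
    by rewrite !exprS expr0 mulr1 !mulrA mulfK ?mulfV ?mul1r ?gt_eqF.
  by rewrite [X in _ <= X -> _]mulrA [X in _ <= X -> _]mulrC mulrA.
rewrite mulr_suml.
apply: (@le_trans _ _ (\sum_(i < size q) `|q`_i| * (x^-1 ^+ i * expR (- x^-1)))).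
  rewrite -[X in _ * X <= _]ger0_norm ?expR_ge0// -normrM mulr_suml.
  apply: (le_trans (ler_norm_sum _ _ _)); apply: ler_sum => i _.
  rewrite -mulrA normrM ler_wpM2l// ger0_norm//.
  by rewrite mulr_ge0 ?expR_ge0// exprn_ge0// invr_ge0 ltW.
by apply: ler_sum => i _; rewrite -mulrA ler_wpM2l.
Qed.

Lemma flat_derive p (x : R) : is_derive x 1 (flat p) (flat ((p - p^`()) * 'X^2) x).
Proof.
have [x0|x0|->] := ltgtP x 0; last 1 first.
- rewrite flat_le0//; have [C hC] := flat_bound p.
  suff : h^-1 *: ((flat p \o shift 0) (h *: (1 : R)) - flat p 0) @[h --> 0^'] --> (0:R).
    move=> hc; split; first by apply/cvg_ex; exists 0.
    exact/cvg_lim.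
  apply/cvgr0Pnorm_le => e e0; near=> h.
  rewrite /= [X in _ - X]flat_le0// subr0 addr0 /GRing.scale/= mulr1 normrM normfV.
  have [h0|h0] := leP h 0; first by rewrite flat_le0// normr0 mulr0 ltW.
  have h1 : h <= 1.
    have : `|h| <= 1 by near: h; apply: dnbhs0_le.
    by rewrite gtr0_norm.
  have hb : `|h| <= e / (`|C| + 1).
    by near: h; apply: dnbhs0_le; rewrite divr_gt0// ltr_wpDl.
  rewrite ler_pdivrMl ?normr_gt0 ?gt_eqF//.
  apply: (le_trans (hC h _)); first by rewrite h0.
  rewrite gtr0_norm// in hb *.
  rewrite expr2 mulrA [_ * e]mulrC ler_wpM2r ?(ltW h0)//.
  rewrite ler_pdivlMr ?ltr_wpDl// in hb.
  apply: le_trans hb; rewrite mulrC ler_wpM2l ?(ltW h0)//.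
  by rewrite (le_trans (ler_norm _))// lerDl.
- rewrite flat_le0 ?(ltW x0)//.
  apply: (@near_eq_is_derive R R R (cst (0:R))).
  near=> y; rewrite flat_le0//; apply: ltW; near: y; exact: lt_nbhsl.
- exact: flat_derive_gt0.
Unshelve. all: by end_near. Qed.

Lemma smooth_flat p : smooth (flat p).
Proof.
apply: (@smooth_coind [set f | exists p, f = flat p]); last by exists p.
move=> _ [q ->]; split=> [x|]; first by have [] := flat_derive q x.
exists ((q - q^`()) * 'X^2); apply/funext => x.
by rewrite derive1E; have [_ ->] := flat_derive q x.
Qed.

Definition bump (a b : R) : R -> R := fun x => flat 1 (x - a) * flat 1 (b - x).

Lemma smooth_bump a b : smooth (bump a b).
Proof.
apply: (@smoothM (fun x => flat 1 (x - a)) (fun x => flat 1 (b - x))).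
  rewrite (_ : (fun x => _) = (fun x => flat 1 (1 * x + - a))).
    by apply: smooth_affine; exact: smooth_flat.
  by apply/funext => x; rewrite mul1r.
rewrite (_ : (fun x => _) = (fun x => flat 1 (-1 * x + b))).
  by apply: smooth_affine; exact: smooth_flat.
by apply/funext => x; rewrite mulN1r addrC.
Qed.

Lemma bump_ge0 a b x : 0 <= bump a b x.
Proof. by rewrite mulr_ge0 ?flat1_ge0. Qed.

Lemma bump_lt1 a b x : bump a b x < 1.
Proof. by rewrite mulr_ilt1 ?flat1_ge0 ?flat1_lt1. Qed.

Lemma bump_gt0 a b x : a < x < b -> 0 < bump a b x.
Proof. by move=> /andP[? ?]; rewrite mulr_gt0// flat1_gt0// subr_gt0. Qed.

Lemma bump_out a b x : ~ (a < x < b) -> bump a b x = 0.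
Proof.
move=> /negP; rewrite negb_and -!leNgt => /orP[h|h]; rewrite /bump.
  by rewrite flat_le0 ?mul0r// subr_le0.
by rewrite (flat_le0 _ (b - x)) ?mulr0// subr_le0.
Qed.

(** As 0 <= bump < 1, with 0 exactly off the interval ]a, b[, these functions are
    smooth and increase to the indicator of ]a, b[. *)
Definition bump_seq (a b : R) n : R -> R := fun x => 1 - (1 - bump a b x) ^+ n.

Lemma smooth_bump_seq a b n : smooth (bump_seq a b n).
Proof.
elim: n => [|n ih].
  have -> : bump_seq a b 0 = cst 0.
    by apply/funext => x; rewrite /bump_seq expr0 subrr.
  exact: smooth_cst.
have -> : bump_seq a b n.+1 =
    bump_seq a b n + (bump a b - bump a b * bump_seq a b n).
  by apply/funext => x; rewrite !fctE /bump_seq exprS; ring.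
have sb := smooth_bump a b.
exact: smoothD ih (smoothB _ _ sb (smoothM _ _ sb ih)).
Qed.

Lemma bump_seq_itv a b n x : 0 <= bump_seq a b n x <= 1.
Proof.
have h0 : 0 <= 1 - bump a b x by rewrite subr_ge0 ltW// bump_lt1.
have h1 : 1 - bump a b x <= 1 by rewrite gerBl bump_ge0.
by rewrite subr_ge0 exprn_ile1//= gerBl exprn_ge0.
Qed.

Lemma bump_seq_out a b n x : ~ (a < x < b) -> bump_seq a b n x = 0.
Proof. by move=> /bump_out h; rewrite /bump_seq h subr0 expr1n subrr. Qed.

Lemma bump_seq_cvg a b x :
  bump_seq a b n x @[n --> \oo] --> (\1_`]a, b[ x : R).
Proof.
have [xab|xab] := boolP (a < x < b).
  rewrite indicE mem_set/= ?in_itv// -[X in _ --> X]subr0.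
  apply: cvgB; first exact: cvg_cst.
  apply: cvg_expr; rewrite ger0_norm; first by rewrite gtrBl bump_gt0.
  by rewrite subr_ge0 ltW// bump_lt1.
rewrite indicE memNset/=; last by rewrite in_itv/=; exact/negP.
have -> : (bump_seq a b)^~ x = (fun=> 0).
  by apply/funext => n; rewrite bump_seq_out//; exact/negP.
exact: cvg_cst.
Qed.

End Smooth.

(** * The Lebesgue measure of (0,1), test functions and L^p *)

Section Leb01.
Context {R : realType}.
Implicit Types (f g u v phi : R -> R) (x : R) (S : set (R -> R)).
Local Notation lam := (@lebesgue_measure R).

Lemma leb01T : @leb01 R [set: R] = 1%E.
Proof.
rewrite /leb01/= /mrestr setTI lebesgue_measure_itv/= lte01.
by rewrite -EFinB subr0.
Qed.

Lemma leb01_out A : A `&` `]0, 1[ = set0 -> @leb01 R A = 0%E.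
Proof. by move=> A0; rewrite /leb01/= /mrestr A0 measure0. Qed.

Lemma leb01_in A : A `<=` `]0, 1[ -> @leb01 R A = lam A.
Proof. by move=> A0; rewrite /leb01/= /mrestr setIidl. Qed.

#[global] Instance ae_leb01_filter : Filter (almost_everywhere (@leb01 R)).
Proof. exact: (ae_filter_ringOfSetsType leb01). Qed.

Lemma ae_leb01_itv : {ae @leb01 R, forall x, 0 < x < 1}.
Proof.
exists (~` `]0, 1[); split; first exact: measurableC.
  by apply: leb01_out; rewrite setIC setICr.
by move=> x /=; rewrite in_itv.
Qed.

Lemma ae_lam_leb01 (P : R -> Prop) :
  {ae lam, forall x, 0 < x < 1 -> P x} -> {ae @leb01 R, forall x, P x}.
Proof.
move=> [N [mN N0 PN]].
have : {ae @leb01 R, forall x, 0 < x < 1 -> P x}.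
  exists N; split => //; apply/eqP; rewrite eq_le measure_ge0 andbT -N0.
  by rewrite /leb01/= /mrestr; apply: le_measure; rewrite ?inE//; exact: measurableI.
by move: ae_leb01_itv; apply: filterS2 => x x01; exact.
Qed.

(** Transfers to [leb01] the results that are stated for the Lebesgue measure of
    the whole line. *)
Lemma integral_leb01 (A : set (measurableTypeR R)) (f : measurableTypeR R -> \bar R) :
  measurable A -> measurable_fun A f ->
  (\int[leb01]_(x in A) f x = \int[lam]_(x in A `&` `]0%R, 1%R[) f x)%E.
Proof.
move=> mA mf; have mAI : measurable (A `&` `]0, 1[) by exact: measurableI.
rewrite -(@eq_measure_integral _ _ _ (A `&` `]0, 1[) lam leb01); last first.
  by move=> B mB BA; rewrite leb01_in// => x /BA[].
rewrite integral_mkcondr; apply: ae_eq_integral => //.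
  by apply/(measurable_restrict _ _ _).1 => //; exact: measurable_funS mf.
move: ae_leb01_itv; apply: filterS => x x01 Ax.
by rewrite patchE mem_set//= in_itv.
Qed.

Lemma Rintegral_leb01 (A : set (measurableTypeR R)) (f : measurableTypeR R -> R) :
  measurable A -> measurable_fun A f ->
  \int[leb01]_(x in A) f x = \int[lam]_(x in A `&` `]0, 1[) f x.
Proof.
by move=> mA mf; rewrite /Rintegral integral_leb01//; exact/measurable_EFinP.
Qed.

Lemma integrable_leb01 (A : set (measurableTypeR R)) (f : measurableTypeR R -> R) :
  measurable A -> measurable_fun A f ->
  (@leb01 R).-integrable A (EFin \o f) <-> lam.-integrable (A `&` `]0, 1[) (EFin \o f).
Proof.
move=> mA mf; have mE : measurable_fun A (EFin \o f) by exact/measurable_EFinP.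
have mE1 : measurable_fun (A `&` `]0, 1[) (EFin \o f).
  by apply: measurable_funS mE.
have mnE : measurable_fun A (abse \o (EFin \o f)) by exact: measurableT_comp.
split=> /integrableP[_ h]; apply/integrableP; split => //.
  by rewrite -(@integral_leb01 A (abse \o (EFin \o f))).
by rewrite (@integral_leb01 A (abse \o (EFin \o f))).
Qed.

End Leb01.

Section TestFunctions.
Context {R : realType}.
Implicit Types (f g u v phi psi : R -> R) (x : R).
Local Notation lam := (@lebesgue_measure R).

Lemma testfun_smooth phi : testfun phi -> smooth phi.
Proof. by case. Qed.

Lemma testfun_measurable phi : testfun phi -> measurable_fun [set: R] phi.
Proof. by move=> /testfun_smooth /smooth_measurable. Qed.

Lemma testfunD phi psi : testfun phi -> testfun psi -> testfun (phi \+ psi).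
Proof.
move=> [sp [a [b [a0 b1 hp]]]] [sq [c [d [c0 d1 hq]]]].
split; first exact: smoothD sp sq.
exists (Num.min a c), (Num.max b d); split.
- by rewrite lt_min a0.
- by rewrite gt_max b1.
- move=> x hx /=; rewrite hp ?hq ?addr0// => /andP[h1 h2]; apply: hx;
  by rewrite ge_min le_max h1 h2 ?orbT.
Qed.

Lemma testfunZ (c : R) phi : testfun phi -> testfun (fun x => c * phi x).
Proof.
move=> [sp [a [b [a0 b1 hp]]]]; split; first exact: smoothZ.
by exists a, b; split => // x hx; rewrite hp// mulr0.
Qed.

Lemma testfunB phi psi : testfun phi -> testfun psi -> testfun (phi \- psi).
Proof.
move=> tp /(testfunZ (-1)) tq.
have -> : phi \- psi = phi \+ (fun x => -1 * psi x).
  by apply/funext => x /=; rewrite mulN1r.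
exact: testfunD.
Qed.

Lemma testfun_derive1 phi : testfun phi -> testfun (derive1 phi).
Proof.
move=> [sp [a [b [a0 b1 hp]]]]; split; first exact: smooth_derive1.
exists a, b; split => // x hx; rewrite derive1E.
rewrite (@near_eq_derive R R R phi (cst 0)) ?derive_cst//.
have {hx} : x < a \/ b < x.
  by case: (ltP x a) => [|ax]; [left|right; rewrite ltNge; apply/negP => xb; apply: hx; rewrite ax].
move=> [xa|bx]; near=> y; rewrite hp// => /andP[ay yb].
  suff : y < a by rewrite ltNge ay.
  by near: y; exact: lt_nbhsl.
suff : b < y by rewrite ltNge yb.
by near: y; exact: lt_nbhsr.
Unshelve. all: by end_near. Qed.

Lemma testfun_bump_seq (a b : R) n : 0 < a -> b < 1 -> testfun (bump_seq a b n).
Proof.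
move=> a0 b1; split; first exact: smooth_bump_seq.
exists a, b; split => // x hx; rewrite bump_seq_out// => /andP[ax xb].
by apply: hx; rewrite !ltW.
Qed.

Lemma testfun_bounded phi : testfun phi -> exists M, forall x, `|phi x| <= M.
Proof.
move=> [sp [a [b [a0 b1 hp]]]].
have [ab|ba] := leP a b; last first.
  exists 0 => x; rewrite hp ?normr0// => /andP[ax xb].
  by move: ba; rewrite ltNge (le_trans ax xb).
have cp : {within `[a, b], continuous (fun x => `|phi x|)}.
  apply: continuous_subspaceT => x; apply: cvg_norm.
  exact: (smooth_continuous _ sp).
have [c _ hc] := EVT_max ab cp.
exists `|phi c| => x; have [xab|xab] := boolP (x \in `[a, b]); first exact: hc.
by rewrite hp ?normr0// => h; move: xab; rewrite in_itv/= h.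
Qed.

End TestFunctions.

Section LpLeb01.
Context {R : realType}.
Implicit Types (f g h b : R -> R) (x : R) (p : \bar R).
Local Notation mu := (@leb01 R).

Lemma LfunE f p : f \in Lfun mu p <->
  measurable_fun [set: R] f /\ ('N[mu]_p[EFin \o f] < +oo)%E.
Proof.
split => [|[mf Nf]].
  by rewrite inE => /andP[]; rewrite !inE.
by rewrite inE; apply/andP; split; rewrite inE.
Qed.

Lemma Lfun_measurable f p : f \in Lfun mu p -> measurable_fun [set: R] f.
Proof. by case/LfunE. Qed.

Lemma ae_abs_le_Linfty f (M : R) :
  ('N[mu]_+oo[EFin \o f] <= M%:E)%E <-> {ae mu, forall x, `|f x| <= M}.
Proof.
have m0 : (0 < mu [set: R])%E by rewrite leb01T lte01.
rewrite unlock /Lnorm m0; split=> [/ess_supP|h].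
  by apply: filterS => x /=; rewrite lee_fin.
by apply/ess_supP; move: h; apply: filterS => x /=; rewrite lee_fin.
Qed.

Lemma Lfun_bounded f (M : R) : measurable_fun [set: R] f ->
  {ae mu, forall x, `|f x| <= M} -> f \in Lfun mu +oo%E.
Proof.
move=> mf fM; apply/LfunE; split => //.
by apply: (@le_lt_trans _ _ M%:E); [exact/ae_abs_le_Linfty|exact: ltry].
Qed.

Lemma Linfty_Lp f p : (1 <= p)%E -> f \in Lfun mu +oo%E -> f \in Lfun mu p.
Proof.
move=> p1; apply: Lfun_subset => //; rewrite ?leey//.
by rewrite leb01T.
Qed.

Lemma L2_L1 f : f \in Lfun mu 2%:E -> f \in Lfun mu 1%E.
Proof. by apply: Lfun_subset12; rewrite leb01T. Qed.

Lemma testfun_Lfun phi p : (1 <= p)%E -> testfun phi -> phi \in Lfun mu p.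
Proof.
move=> p1 tp; have [M hM] := testfun_bounded _ tp.
apply: Linfty_Lp => //; apply: (@Lfun_bounded _ M).
  exact: testfun_measurable.
exact: nearW.
Qed.

Lemma le_Lnorm f g (r : R) : 1 <= r ->
  measurable_fun [set: R] f -> measurable_fun [set: R] g ->
  {ae mu, forall x, `|f x| <= `|g x|} ->
  ('N[mu]_(r%:E)[EFin \o f] <= 'N[mu]_(r%:E)[EFin \o g])%E.
Proof.
move=> r1 mf mg fg; rewrite unlock /Lnorm.
have r0 : 0 <= r by rewrite (le_trans ler01).
have mr h : measurable_fun [set: R] h ->
    measurable_fun [set: R] (fun x => `|(EFin \o h) x| `^ r)%E.
  move=> mh; apply/measurable_EFinP.
  apply: (@measurableT_comp _ _ _ _ _ _ (fun x : R => x `^ r)) => //.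
  exact: measurableT_comp.
have i0 h : (0 <= \int[mu]_x (`|(EFin \o h) x| `^ r))%E.
  by apply: integral_ge0 => x _; rewrite /= lee_fin powR_ge0.
apply: gt0_ler_poweR; rewrite ?invr_ge0 ?in_itv/= ?leey ?andbT//; try exact: i0.
apply: ae_ge0_le_integral; [exact: measurableT| |exact: mr| |exact: mr|].
- by move=> x _; rewrite /= lee_fin powR_ge0.
- by move=> x _; rewrite /= lee_fin powR_ge0.
move: fg; apply: filterS => x fgx _.
by rewrite /= lee_fin ge0_ler_powR.
Qed.

Lemma Lfun_le f g (r : R) : 1 <= r -> measurable_fun [set: R] f ->
  g \in Lfun mu r%:E -> {ae mu, forall x, `|f x| <= `|g x|} -> f \in Lfun mu r%:E.
Proof.
move=> r1 mf /LfunE[mg Ng] fg; apply/LfunE; split => //.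
by apply: le_lt_trans Ng; exact: le_Lnorm.
Qed.

Lemma LfunZ (c : R) f (r : R) : 1 <= r -> f \in Lfun mu r%:E ->
  (fun x => c * f x) \in Lfun mu r%:E.
Proof.
have -> : (fun x => c * f x) = c \o* f by apply/funext => x /=; rewrite mulrC.
exact: Lfun_scale.
Qed.

Lemma LfunD f g p : (1 <= p)%E -> f \in Lfun mu p -> g \in Lfun mu p ->
  (f \+ g) \in Lfun mu p.
Proof. by move=> p1 fp gp; exact: (Lfun_addr_closed mu p1).2. Qed.

Lemma LfunN f p : (1 <= p)%E -> f \in Lfun mu p -> (\- f) \in Lfun mu p.
Proof. by move=> p1 fp; exact: (@Lfun_oppr_closed _ _ _ mu p f fp). Qed.

Lemma LfunB f g p : (1 <= p)%E -> f \in Lfun mu p -> g \in Lfun mu p ->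
  (f \- g) \in Lfun mu p.
Proof. by move=> p1 fp gp; apply: LfunD => //; exact: LfunN. Qed.

Lemma LfunM_bounded f g (r M : R) : 1 <= r -> measurable_fun [set: R] f ->
  {ae mu, forall x, `|f x| <= M} -> g \in Lfun mu r%:E ->
  (f \* g) \in Lfun mu r%:E.
Proof.
move=> r1 mf fM gr; apply: (Lfun_le _ (fun x => M * g x) _ r1); [|exact: LfunZ|].
  by apply: measurable_funM => //; exact: Lfun_measurable gr.
move: fM; apply: filterS => x fM /=; rewrite !normrM ler_wpM2r//.
by rewrite (le_trans fM)// ler_norm.
Qed.

Lemma LfunM2 f g : f \in Lfun mu 2%:E -> g \in Lfun mu 2%:E ->
  (f \* g) \in Lfun mu 1%E.
Proof. exact: Lfun2_mul_Lfun1. Qed.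

Lemma L1_integrable f : f \in Lfun mu 1%E -> mu.-integrable [set: R] (EFin \o f).
Proof. by move/Lfun1_integrable. Qed.

Lemma Rint_ae_eq f g : measurable_fun [set: R] f -> measurable_fun [set: R] g ->
  {ae mu, forall x, f x = g x} -> \int[mu]_x f x = \int[mu]_x g x.
Proof.
move=> mf mg fg; congr fine; apply: ae_eq_integral => //; try exact/measurable_EFinP.
by move: fg; apply: filterS => x -> _.
Qed.

Lemma RintB f g : f \in Lfun mu 1%E -> g \in Lfun mu 1%E ->
  \int[mu]_x (f x - g x) = \int[mu]_x f x - \int[mu]_x g x.
Proof. by move=> f1 g1; rewrite RintegralB//; exact: L1_integrable. Qed.

Lemma RintD f g : f \in Lfun mu 1%E -> g \in Lfun mu 1%E ->
  \int[mu]_x (f x + g x) = \int[mu]_x f x + \int[mu]_x g x.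
Proof. by move=> f1 g1; rewrite RintegralD//; exact: L1_integrable. Qed.

Lemma RintZ (c : R) f : f \in Lfun mu 1%E ->
  \int[mu]_x (c * f x) = c * \int[mu]_x f x.
Proof. by move=> f1; rewrite RintegralZl//; exact: L1_integrable. Qed.

Lemma Rint_dct (f_ : nat -> R -> R) f g :
  (forall n, measurable_fun [set: R] (f_ n)) -> measurable_fun [set: R] f ->
  g \in Lfun mu 1%E -> {ae mu, forall x, forall n, `|f_ n x| <= g x} ->
  {ae mu, forall x, f_ n x @[n --> \oo] --> f x} ->
  \int[mu]_x f_ n x @[n --> \oo] --> \int[mu]_x f x.
Proof.
move=> mf_ mf g1 fg ff.
have [] := @dominated_convergence _ _ _ mu [set: R] measurableT
  (fun n => EFin \o f_ n) (EFin \o f) (EFin \o g).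
- by move=> n; apply/measurable_EFinP; exact: mf_.
- exact/measurable_EFinP.
- by move: ff; apply: filterS => x h _; apply: cvg_EFin => //; exact: nearW.
- exact: L1_integrable.
- by move: fg; apply: filterS => x h n _; rewrite /= lee_fin.
move=> intf _ h.
by apply: fine_cvg; rewrite fineK//; exact: integrable_fin_num.
Qed.

End LpLeb01.

(** * The fundamental lemma of the calculus of variations *)

Section Fundamental.
Context {R : realType}.
Implicit Types (f g h phi psi : R -> R) (x : R).
Local Notation lam := (@lebesgue_measure R).
Local Notation mu := (@leb01 R).

(** A function of L^1(0,1) is arbitrary outside (0,1); extended by 0 it is
    integrable on the line. *)
Definition restr01 h : R -> R := h \_ `]0, 1[.

Lemma measurable_restr01 h : measurable_fun [set: R] h ->
  measurable_fun [set: R] (restr01 h).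
Proof.
move=> mh; apply/(measurable_restrictT _ _).1 => //.
exact: measurable_funTS.
Qed.

Lemma restr01_integrable h : h \in Lfun mu 1%E ->
  lam.-integrable [set: R] (EFin \o restr01 h).
Proof.
move=> h1; have := L1_integrable _ h1.
move/(integrable_leb01 _ _ measurableT (Lfun_measurable _ _ h1)).
rewrite setTI => /integrable_mkcond; rewrite restrict_EFin; exact.
Qed.

Lemma Rint_restr01 h A : measurable A -> measurable_fun [set: R] h ->
  \int[lam]_(x in A) restr01 h x = \int[mu]_(x in A) h x.
Proof.
move=> mA mh; rewrite Rintegral_leb01//; last exact: measurable_funTS.
by rewrite /restr01 Rintegral_mkcondr.
Qed.

(** Taking the integral from -oo makes this primitive defined and continuous on the
    whole line, with no distinction of cases at 0; on (0,1) it is int_0^x h. *)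
Definition prim h x : R := \int[lam]_(t in `]-oo, x]) restr01 h t.

Lemma primB h (x y : R) : h \in Lfun mu 1%E -> x <= y ->
  prim h y - prim h x = \int[lam]_(t in `]x, y]) restr01 h t.
Proof.
move=> h1 xy; rewrite /prim Rintegral_itvB//.
by apply: integrableS (restr01_integrable _ h1).
Qed.

(** Testing g against functions that increase to the indicator of ]a, b[ shows that
    its integral over every subinterval is nonnegative.  Its primitive is therefore
    nondecreasing, and g is a.e. the derivative of its primitive. *)
Lemma fundamental_ge0 g : g \in Lfun mu 1%E ->
  (forall phi, testfun phi -> (forall x, 0 <= phi x) ->
    0 <= \int[mu]_x (g x * phi x)) ->
  {ae mu, forall x, 0 <= g x}.
Proof.
move=> g1 hg; have mg := Lfun_measurable _ _ g1.
have itv_ge0 (a b : R) : 0 < a -> b < 1 -> 0 <= \int[mu]_(x in `]a, b[) g x.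
  move=> a0 b1; rewrite Rintegral_mkcond.
  have -> : g \_ `]a, b[ = (fun x => g x * \1_`]a, b[ x) by rewrite patch_indic.
  have cv : \int[mu]_x (g x * bump_seq a b n x) @[n --> \oo] -->
      \int[mu]_x (g x * \1_`]a, b[ x).
    apply: (Rint_dct _ _ (fun x => `|g x|)).
    - by move=> n; apply: measurable_funM => //; exact: smooth_measurable (smooth_bump_seq _ _ _).
    - by apply: measurable_funM => //; exact: measurable_indic.
    - exact: Lfun_norm.
    - apply: nearW => x n; have /andP[b0 b1'] := bump_seq_itv a b n x.
      by rewrite normrM ler_piMr// ger0_norm.
    - by apply: nearW => x; apply: cvgM; [exact: cvg_cst|exact: bump_seq_cvg].
  rewrite -(cvg_lim _ cv)//; apply: limr_ge; first by apply/cvg_ex; eexists; exact: cv.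
  apply: nearW => n; apply: hg; first exact: testfun_bump_seq.
  by move=> x; have /andP[] := bump_seq_itv a b n x.
have iG := restr01_integrable _ g1.
have lG : locally_integrable [set: R] (restr01 g).
  have := @integrable_locally R g `]0, 1[ _; apply => //.
  have := L1_integrable _ g1.
  by move/(integrable_leb01 _ _ measurableT (Lfun_measurable _ _ g1)); rewrite setTI.
have iGy y : lam.-integrable `]-oo, y] (EFin \o restr01 g).
  exact: integrableS iG.
apply: ae_lam_leb01.
have := FTC1Ny iGy lG.
apply: filterS; first exact: (ae_filter_ringOfSetsType lam).
move=> x; rewrite -/(prim g) => -[dF Fx] x01.
have -> : g x = restr01 g x by rewrite /restr01 patchE mem_set//= in_itv.
rewrite -Fx derive1E /derive.
have cF := @cvg_dnbhs_at_right R R _ _ _ dF.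
rewrite -(cvg_lim _ cF)//; apply: limr_ge; first by apply/cvg_ex; eexists; exact: cF.
near=> e.
have e0 : 0 < e by [].
have xe1 : x + e < 1.
  rewrite -ltrBrDl; near: e; apply: nbhs_right_lt; rewrite subr_gt0.
  by have /andP[] := x01.
rewrite /= /GRing.scale/= mulr1 mulr_ge0 ?invr_ge0 ?(ltW e0)//.
rewrite [e + x]addrC primB ?lerDl ?(ltW e0)//.
rewrite -Rintegral_itv_bndo_bndc; last exact: integrableS iG.
rewrite Rint_restr01//; apply: itv_ge0 => //.
by have /andP[] := x01.
Unshelve. all: by end_near. Qed.

Lemma fundamental_eq0 g : g \in Lfun mu 1%E ->
  (forall phi, testfun phi -> \int[mu]_x (g x * phi x) = 0) ->
  {ae mu, forall x, g x = 0}.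
Proof.
move=> g1 hg.
have p : {ae mu, forall x, 0 <= g x}.
  by apply: fundamental_ge0 => // phi tphi _; rewrite hg.
have n : {ae mu, forall x, 0 <= - g x}.
  apply: (fundamental_ge0 (\- g)); first exact: LfunN.
  move=> phi tphi _; have := hg _ (testfunZ (-1) _ tphi).
  by under eq_Rintegral do rewrite mulN1r mulrN -mulNr; move=> ->.
move: p n; apply: filterS2 => x g0; rewrite oppr_ge0 => g0'.
by apply/eqP; rewrite eq_le g0 g0'.
Qed.

End Fundamental.

(** * Primitives *)

Section Primitive.
Context {R : realType}.
Implicit Types (f g h phi psi : R -> R) (x : R).
Local Notation lam := (@lebesgue_measure R).
Local Notation mu := (@leb01 R).

Lemma prim_continuous h : h \in Lfun mu 1%E -> continuous (prim h).
Proof.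
move=> h1 x; apply/cvgrPdist_lt => /= e e0.
have ih := restr01_integrable _ h1.
have [d [d0 hd]] := integral_normr_continuous ih e0.
have key (y z : R) : y <= z -> z - y < d -> `|prim h z - prim h y| < e.
  move=> yz zyd; rewrite primB//.
  have ii : lam.-integrable `]y, z] (EFin \o restr01 h) by exact: integrableS ih.
  have ltd : (lam `]y, z] < d%:E)%E.
    by rewrite lebesgue_measure_itv/=; case: ifPn => // _; rewrite -EFinB lte_fin.
  by apply: le_lt_trans (le_normr_Rintegral _ ii) _ => //; exact: hd.
near=> y; have xy : `|x - y| < d by near: y; apply: cvgr_dist_lt.
have [le_xy|/ltW le_yx] := leP x y.
  rewrite distrC key//; apply: le_lt_trans xy; rewrite distrC ler_norm//.
by rewrite key//; apply: le_lt_trans xy; rewrite ler_norm.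
Unshelve. all: by end_near. Qed.

Lemma prim_measurable h : h \in Lfun mu 1%E -> measurable_fun [set: R] (prim h).
Proof. by move=> /prim_continuous; exact: continuous_measurable_fun. Qed.

Lemma primE h x : h \in Lfun mu 1%E -> prim h x = \int[mu]_(t in `]-oo, x]) h t.
Proof. by move=> h1; rewrite /prim Rint_restr01//; exact: Lfun_measurable h1. Qed.

Lemma prim_norm_le h x : h \in Lfun mu 1%E -> `|prim h x| <= \int[mu]_t `|h t|.
Proof.
move=> h1; have ih := L1_integrable _ h1.
have iS : mu.-integrable `]-oo, x] (EFin \o h) by exact: integrableS ih.
rewrite primE//; apply: le_trans (le_normr_Rintegral _ iS) _ => //.
rewrite Rintegral_mkcond; apply: le_Rintegral => //.
- rewrite -restrict_EFin; apply: (integrable_mkcond _ _).1 => //.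
  exact: integrable_norm iS.
- exact: integrable_norm ih.
- by move=> y _; rewrite patchE; case: ifPn => _ /=; rewrite ?lexx ?normr_ge0.
Qed.

Lemma prim_bounded h : h \in Lfun mu 1%E -> prim h \in Lfun mu +oo%E.
Proof.
move=> h1; apply: (Lfun_bounded _ (\int[mu]_t `|h t|)).
  exact: prim_measurable.
by apply: nearW => x; exact: prim_norm_le.
Qed.

Lemma primL2 f : f \in Lfun mu 1%E -> prim f \in Lfun mu 2%:E.
Proof. by move=> f1; apply: Linfty_Lp; [rewrite lee1n|exact: prim_bounded]. Qed.

Lemma prim_linear (c : R) f g x : f \in Lfun mu 1%E -> g \in Lfun mu 1%E ->
  prim (fun t => c * f t + g t) x = c * prim f x + prim g x.
Proof.
move=> f1 g1; have cf := LfunZ c _ _ (lexx 1) f1.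
rewrite !primE//; last exact: LfunD.
have iS h : h \in Lfun mu 1%E -> mu.-integrable `]-oo, x] (EFin \o h).
  by move=> /L1_integrable; exact: integrableS.
by rewrite RintegralD ?RintegralZl//; exact: iS.
Qed.

Lemma prim_ge1 h x : h \in Lfun mu 1%E -> 1 <= x -> prim h x = \int[mu]_t h t.
Proof.
move=> h1 x1; have mh := Lfun_measurable _ _ h1.
rewrite primE// !Rintegral_leb01//; last exact: measurable_funTS.
congr (Rintegral _ _ _); rewrite setTI setIidr// => t /=; rewrite !in_itv/=.
by move=> /andP[_ /ltW t1]; exact: le_trans t1 x1.
Qed.

Lemma testfun_out phi x : testfun phi -> ~ (0 < x < 1) -> phi x = 0.
Proof.
move=> [_ [a [b [a0 b1 h]]]] x01; apply: h => /andP[ax xb]; apply: x01.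
by rewrite (lt_le_trans a0 ax) (le_lt_trans xb b1).
Qed.

Lemma testfun_restr01 phi : testfun phi -> restr01 phi = phi.
Proof.
move=> tphi; apply/funext => x; rewrite /restr01 patchE; case: ifPn => //.
by move/negP => hx; rewrite (testfun_out _ _ tphi)// => h; apply: hx; rewrite inE/= in_itv.
Qed.

Lemma testfun_L1 phi : testfun phi -> phi \in Lfun mu 1%E.
Proof. exact: testfun_Lfun. Qed.

Lemma prim_derive phi x : testfun phi ->
  derivable (prim phi) x 1 /\ derive1 (prim phi) x = phi x.
Proof.
move=> tphi; have ih := restr01_integrable _ (testfun_L1 _ tphi).
have -> : prim phi = fun x => \int[lam]_(t in `]-oo, x]) phi t.
  by rewrite /prim testfun_restr01.
apply: (@continuous_FTC1 R phi -oo%O x (x + 1)) => //.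
- by rewrite ltrDl.
- by rewrite -(testfun_restr01 _ tphi); exact: integrableS ih.
- by rewrite ltNyr.
- by move: x; exact: (smooth_continuous _ (testfun_smooth _ tphi)).
Qed.

Lemma prim_testfun_eq0 phi (a x : R) : (forall t, ~ (a <= t) -> phi t = 0) ->
  testfun phi -> x < a -> prim phi x = 0.
Proof.
move=> ha tphi xa; rewrite /prim testfun_restr01//.
transitivity (\int[lam]_(t in `]-oo, x]) (cst 0 t : R)).
  apply: eq_Rintegral => t; rewrite inE/= in_itv/= => tx; apply: ha.
  by apply/negP; rewrite -ltNge (le_lt_trans tx).
by rewrite Rintegral_cst// mul0r.
Qed.

Lemma prim_testfun_tot phi (b x : R) : (forall t, ~ (t <= b) -> phi t = 0) ->
  testfun phi -> b < x -> prim phi x = \int[mu]_t phi t.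
Proof.
move=> hb tphi bx; have p1 := testfun_L1 _ tphi.
have [x1|x1] := leP 1 x; first exact: prim_ge1.
rewrite -(prim_ge1 _ 1 p1)//; apply/esym/eqP; rewrite -subr_eq0 primB ?ltW//.
rewrite testfun_restr01//.
rewrite (_ : Rintegral _ _ _ = \int[lam]_(t in `]x, 1]) (cst 0 t : R)).
  by rewrite Rintegral_cst// mul0r.
apply: eq_Rintegral => t; rewrite inE/= in_itv/= => /andP[xt _]; apply: hb.
by apply/negP; rewrite -ltNge (lt_trans bx).
Qed.

(** To the right of the support of phi the primitive is constant, equal to the
    integral of phi: zero mean is what gives it compact support. *)
Lemma prim_testfun phi : testfun phi -> \int[mu]_t phi t = 0 -> testfun (prim phi).
Proof.
move=> tphi phi0; have dE : derive1 (prim phi) = phi.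
  by apply/funext => x; have [] := prim_derive _ x tphi.
split.
  apply: (@smooth_coind _ [set f | f = prim phi \/ smooth f]); last by left.
  move=> f [->|sf]; split=> [x|].
  - by have [] := prim_derive _ x tphi.
  - by right; rewrite dE; exact: testfun_smooth.
  - exact: smooth_derivable.
  - by right; exact: smooth_derive1.
have [_ [a [b [a0 b1 hab]]]] := tphi.
exists a, b; split => // x xab; have [xa|ax] := ltP x a.
  by apply: (prim_testfun_eq0 _ a) => // t ht; apply: hab => /andP[].
rewrite (prim_testfun_tot _ b)//; first by move=> t ht; apply: hab => /andP[].
by rewrite ltNge; apply/negP => xb; apply: xab; rewrite ax.
Qed.

Lemma prim_derive1 phi : testfun phi -> prim (derive1 phi) = phi.
Proof.
move=> tphi; have tdphi := testfun_derive1 _ tphi.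
have d0 x : is_derive x 1 (prim (derive1 phi) - phi) 0.
  have [dp1 dp2] := prim_derive _ x tdphi.
  have D1 : is_derive x 1 (prim (derive1 phi)) (derive1 phi x).
    by split; [exact: dp1|rewrite -derive1E; exact: dp2].
  have D2 := smooth_is_derive phi x (testfun_smooth _ tphi).
  have := is_deriveB D1 D2; rewrite subrr; exact.
have [_ [a [b [a0 b1 hab]]]] := tphi.
have [_ [c [d [c0 _ hcd]]]] := tdphi.
apply/funext => x; have := is_derive_0_is_cst x 0 d0.
rewrite !fctE (prim_testfun_eq0 _ c 0) ?(testfun_out _ 0 tphi) ?ltxx//.
  by rewrite subrr => /eqP; rewrite subr_eq0 => /eqP.
by move=> t ht; apply: hcd => /andP[].
Qed.

Lemma Rint_derive1 phi : testfun phi -> \int[mu]_x derive1 phi x = 0.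
Proof.
move=> tphi; have tdphi := testfun_derive1 _ tphi.
rewrite -(prim_ge1 _ 1 (testfun_L1 _ tdphi))// prim_derive1//.
by rewrite (testfun_out _ 1 tphi)// ltxx andbF.
Qed.

End Primitive.

(** * The weak derivative of a primitive *)

Section WeakDerivative.
Context {R : realType}.
Implicit Types (f g h phi psi u v : R -> R) (x : R).
Local Notation lam := (@lebesgue_measure R).
Local Notation mu := (@leb01 R).

Lemma LfunM_testfun h phi (r : R) : 1 <= r -> h \in Lfun mu r%:E ->
  testfun phi -> (fun x => h x * phi x) \in Lfun mu r%:E.
Proof.
move=> r1 hr tphi; have [M hM] := testfun_bounded _ tphi.
have -> : (fun x => h x * phi x) = phi \* h by apply/funext => x; rewrite /= mulrC.
by apply: (LfunM_bounded _ _ _ M) => //; [exact: testfun_measurable|exact: nearW].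
Qed.

Lemma restr01E h x : restr01 h x = if 0 < x < 1 then h x else 0.
Proof.
rewrite /restr01 patchE; case: ifPn => [|/negP hx]; first by rewrite inE/= in_itv/= => ->.
by case: ifPn => // x01; exfalso; apply: hx; rewrite inE/= in_itv.
Qed.

Lemma restr01M f phi : testfun phi ->
  restr01 (fun x => f x * phi x) = (fun x => f x * phi x).
Proof.
move=> tphi; apply/funext => x; rewrite /restr01 patchE; case: ifPn => // /negP hx.
rewrite (testfun_out phi x tphi) ?mulr0// => x01.
by apply: hx; rewrite inE/= in_itv.
Qed.

(* Points of the plane are (x, t); Fubini is applied over the region t < x. *)
Let below : set (R * R) := [set z | z.2 < z.1].

Let measurable_below : measurable below.
Proof.
have mf : measurable_fun [set: R * R] (fun z : R * R => z.2 < z.1).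
  by apply: measurable_fun_ltr; [exact: measurable_snd|exact: measurable_fst].
have m1 : measurable [set true] by [].
rewrite (_ : below = [set: R * R] `&` (fun z : R * R => z.2 < z.1) @^-1` [set true]).
  exact: mf measurableT _ m1.
by rewrite setTI; apply/seteqP; split=> z.
Qed.

Let kernel h phi : R * R -> R := fun z =>
  derive1 phi z.1 * (restr01 h z.2 * \1_below z).

Let measurable_kernel h phi : h \in Lfun mu 1%E -> testfun phi ->
  measurable_fun [set: R * R] (kernel h phi).
Proof.
move=> h1 tphi; have tdphi := testfun_derive1 _ tphi.
apply: measurable_funM; last (apply: measurable_funM; last exact: measurable_indic).
  exact: measurableT_comp (testfun_measurable _ tdphi) measurable_fst.
exact: measurableT_comp (measurable_restr01 _ (Lfun_measurable _ _ h1)) measurable_snd.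
Qed.

Let integrable_kernel h phi : h \in Lfun mu 1%E -> testfun phi ->
  (lam \x lam)%E.-integrable [set: R * R] (EFin \o kernel h phi).
Proof.
move=> h1 tphi; have tdphi := testfun_derive1 _ tphi.
have iG := restr01_integrable _ h1.
have iD := restr01_integrable _ (testfun_L1 _ tdphi).
rewrite testfun_restr01// in iD.
have mk := measurable_kernel _ _ h1 tphi.
have mG : measurable_fun [set: R] (fun t => `|restr01 h t|%:E).
  apply/measurable_EFinP; apply: measurableT_comp => //.
  exact: measurable_restr01 (Lfun_measurable _ _ h1).
apply/integrable12ltyP; first exact/measurable_EFinP.
apply: (@le_lt_trans _ _
    (\int[lam]_x (`|derive1 phi x|%:E * \int[lam]_t `|(restr01 h t)%:E|))%E).
  apply: ge0_le_integral => //.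
  - by move=> x _; exact: integral_ge0.
  - apply: (@measurable_fun_fubini_tonelli_F _ _ _ _ _ lam (abse \o (EFin \o kernel h phi))) => //.
      by apply: measurableT_comp => //; exact/measurable_EFinP.
    by move=> z /=; rewrite lee_fin.
  - apply: emeasurable_funM; last exact: measurable_cst.
    apply/measurable_EFinP; apply: measurableT_comp => //.
    exact: testfun_measurable.
  - move=> x _; rewrite -ge0_integralZl//=.
    apply: ge0_le_integral => //.
    + apply/measurable_EFinP; apply: measurableT_comp => //.
      exact: (measurableT_comp mk (pair1_measurable x)).
    + exact: measurable_funeM.
    + move=> t _; rewrite -EFinM lee_fin /kernel/= !normrM ler_wpM2l// ler_piMr//.
      by rewrite ger0_norm ?indic_le1.
have [_ hG] := (integrableP _ _ _ iG).
have [_ hD] := (integrableP _ _ _ iD).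
rewrite ge0_integralZr//=; last by exact: integral_ge0.
  by rewrite lte_mul_pinfty// ?integral_ge0// ge0_fin_numE ?integral_ge0.
apply/measurable_EFinP; apply: measurableT_comp => //.
exact: testfun_measurable.
Qed.

(** With [kernel_integral2]: integrating derive1 phi x * h t over t < x in one order
    gives (prim h) phi', in the other one - h phi, since the integral of phi' over
    x > t is - phi t. *)
Lemma kernel_integral1 h phi x : h \in Lfun mu 1%E ->
  (\int[lam]_t (kernel h phi (x, t))%:E = (prim h x * derive1 phi x)%:E)%E.
Proof.
move=> h1; have iG := restr01_integrable _ h1.
have iGx : lam.-integrable `]-oo, x[ (EFin \o restr01 h) by exact: integrableS iG.
rewrite mulrC /prim -Rintegral_itv_bndo_bndc; last exact: integrableS iG.
rewrite EFinM /Rintegral fineK; last exact: integrable_fin_num.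
have -> : (fun t => (kernel h phi (x, t))%:E) =
    (fun t => (derive1 phi x)%:E * ((EFin \o restr01 h) \_ `]-oo, x[) t)%E.
  apply/funext => t; rewrite /kernel EFinM; congr (_ * _)%E.
  rewrite patchE indicE; case: ifPn.
    by rewrite inE/= in_itv/= => tx; rewrite mem_set// mulr1.
  move=> tx; rewrite memNset ?mulr0// => tx'.
  by move/negP: tx; rewrite inE/= in_itv/=; apply.
rewrite integralZl//; last by apply: (integrable_mkcond _ _).1.
by rewrite -integral_mkcond.
Qed.

Lemma kernel_integral2 h phi t : testfun phi ->
  (\int[lam]_x (kernel h phi (x, t))%:E = (- (restr01 h t * phi t))%:E)%E.
Proof.
move=> tphi; have tdphi := testfun_derive1 _ tphi.
have iD := restr01_integrable _ (testfun_L1 _ tdphi).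
rewrite testfun_restr01// in iD.
have e : \int[lam]_(x in `]t, +oo[) derive1 phi x = - phi t.
  rewrite -(@Rintegral_itvB R (derive1 phi) -oo%O +oo%O t) ?set_itvE//.
  have -> : \int[lam]_x derive1 phi x = 0.
    rewrite -(Rint_derive1 _ tphi) -Rint_restr01 ?testfun_restr01//.
    exact: testfun_measurable.
  by rewrite sub0r -[in RHS](prim_derive1 phi)// /prim testfun_restr01.
rewrite -mulrN -e EFinM /Rintegral fineK; last first.
  by apply: integrable_fin_num => //; exact: integrableS iD.
have -> : (fun x => (kernel h phi (x, t))%:E) =
    (fun x => (restr01 h t)%:E * ((EFin \o derive1 phi) \_ `]t, +oo[) x)%E.
  apply/funext => x; rewrite /kernel mulrCA EFinM; congr (_ * _)%E.
  rewrite patchE indicE; case: ifPn.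
    by rewrite inE/= in_itv/= andbT => tx; rewrite mem_set// mulr1.
  move=> tx; rewrite memNset ?mulr0// => tx'.
  by move/negP: tx; rewrite inE/= in_itv/= andbT; apply.
rewrite integralZl//; last first.
  by apply: (integrable_mkcond _ _).1 => //; exact: integrableS iD.
by rewrite -integral_mkcond.
Qed.

Lemma prim_weak_derivative h (c : R) : h \in Lfun mu 1%E ->
  weak_derivative (fun x => prim h x + c) h.
Proof.
move=> h1 phi tphi; have tdphi := testfun_derive1 _ tphi.
have F := Fubini (integrable_kernel _ _ h1 tphi).
have p1 : (fun x => prim h x * derive1 phi x) \in Lfun mu 1%E.
  have d2 : derive1 phi \in Lfun mu 2%:E by apply: testfun_Lfun; rewrite ?lee1n.
  exact: LfunM2 (primL2 _ h1) d2.
transitivity (\int[mu]_x (prim h x * derive1 phi x)).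
  under eq_Rintegral do rewrite mulrDl.
  rewrite (RintD _ _ p1 (LfunZ c _ _ (lexx 1) (testfun_L1 _ tdphi))).
  by rewrite (RintZ c _ (testfun_L1 _ tdphi)) (Rint_derive1 _ tphi) mulr0 addr0.
have e1 : \int[mu]_x (prim h x * derive1 phi x) =
    \int[lam]_x (prim h x * derive1 phi x).
  by rewrite -(Rint_restr01 _ _ measurableT (Lfun_measurable _ _ p1)) (restr01M _ _ tdphi).
have hphi1 : (fun x => h x * phi x) \in Lfun mu 1%E.
  exact: LfunM_testfun.
have hphiN1 := LfunZ (-1) _ _ (lexx 1) hphi1.
have e2 : (- \int[mu]_x (h x * phi x)) = \int[lam]_x (- (restr01 h x * phi x)).
  rewrite -mulN1r -(RintZ (-1) _ hphi1).
  rewrite -(Rint_restr01 _ _ measurableT (Lfun_measurable _ _ hphiN1)).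
  apply: eq_Rintegral => x _; rewrite !restr01E.
  by case: ifPn => _; [rewrite mulN1r|rewrite mul0r oppr0].
rewrite e1 e2; congr fine.
have k1 := kernel_integral1 h phi _ h1.
have k2 := kernel_integral2 h phi _ tphi.
apply: etrans (etrans _ F) _; apply: eq_integral => x _.
  exact: esym (k1 x).
exact: k2.
Qed.

End WeakDerivative.

(** * The space H and integration by parts *)

Section SobolevH.
Context {R : realType}.
Implicit Types (f g h phi psi rho u v : R -> R) (x : R).
Local Notation lam := (@lebesgue_measure R).
Local Notation mu := (@leb01 R).

Lemma le_Rint_ae f g : f \in Lfun mu 1%E -> g \in Lfun mu 1%E ->
  {ae mu, forall x, f x <= g x} -> \int[mu]_x f x <= \int[mu]_x g x.
Proof.
move=> f1 g1 fg; rewrite -subr_ge0 -(RintB _ _ g1 f1).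
have gf1 := LfunB _ _ _ (lexx 1%E) g1 f1.
rewrite (Rint_ae_eq _ (fun x => `|g x - f x|)).
- by apply: Rintegral_ge0 => x _.
- exact: Lfun_measurable gf1.
- exact: Lfun_measurable (Lfun_norm gf1).
- by move: fg; apply: filterS => x fg; rewrite ger0_norm ?subr_ge0.
Qed.

Lemma weak_derivative_unique u g h : g \in Lfun mu 1%E -> h \in Lfun mu 1%E ->
  weak_derivative u g -> weak_derivative u h -> {ae mu, forall x, g x = h x}.
Proof.
move=> g1 h1 wg wh.
have : {ae mu, forall x, (g \- h) x = 0}.
  apply: fundamental_eq0; first exact: LfunB.
  move=> phi tphi; under eq_Rintegral do rewrite mulrBl.
  rewrite (RintB _ _ (LfunM_testfun _ _ _ (lexx 1) g1 tphi)
    (LfunM_testfun _ _ _ (lexx 1) h1 tphi)).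
  by have := wh _ tphi; rewrite (wg _ tphi) => /oppr_inj ->; rewrite subrr.
by apply: filterS => x /= /eqP; rewrite subr_eq0 => /eqP.
Qed.

Lemma wderivP u : sobolevH1 u ->
  wderiv u \in Lfun mu 2%:E /\ weak_derivative u (wderiv u).
Proof. by move=> [_ h]; exact: (getPex h). Qed.

(** [wderiv] chooses some weak derivative; by uniqueness it agrees a.e. with any one
    that is known explicitly. *)
Lemma wderiv_ae u g : g \in Lfun mu 2%:E -> weak_derivative u g ->
  wderiv u \in Lfun mu 2%:E /\ {ae mu, forall x, wderiv u x = g x}.
Proof.
move=> g2 wg.
have [w2 ww] : wderiv u \in Lfun mu 2%:E /\ weak_derivative u (wderiv u).
  by apply: (@getPex _ [set g | g \in Lfun mu 2%:E /\ weak_derivative u g]); exists g.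
by split => //; apply: (weak_derivative_unique u) => //; exact: L2_L1.
Qed.

(** With [wderiv_prim]: every h in L^2 is the derivative of an element of H, which
    supplies both the solution of the variational problem and the test elements that
    determine it. *)
Lemma sobolevH_prim h : h \in Lfun mu 2%:E ->
  sobolevH (fun x => prim h x - prim h 1).
Proof.
move=> h2; have h1 := L2_L1 _ h2.
have mp : measurable_fun [set: R] (fun x => prim h x - prim h 1).
  by apply: measurable_funB => //; exact: prim_measurable.
split; last first.
  exists (fun x => prim h x - prim h 1); split; [|exact: nearW|by rewrite subrr].
  apply: continuous_subspaceT => x; apply: cvgB; last exact: cvg_cst.
  exact: (prim_continuous _ h1).
split; last by exists h; split => //; exact: prim_weak_derivative.
apply: Linfty_Lp; first by rewrite lee1n.
apply: (Lfun_bounded _ (\int[mu]_t `|h t| + `|prim h 1|)) => //.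
apply: nearW => x; apply: le_trans (ler_normB _ _) _.
by rewrite lerD2r prim_norm_le.
Qed.

Lemma wderiv_prim h (c : R) : h \in Lfun mu 2%:E ->
  wderiv (fun x => prim h x + c) \in Lfun mu 2%:E /\
  {ae mu, forall x, wderiv (fun x => prim h x + c) x = h x}.
Proof. by move=> h2; apply: wderiv_ae => //; apply: prim_weak_derivative; exact: L2_L1. Qed.

(** The integrals of [bump_seq] tend to b - a > 0, so that one of them is positive
    and can be normalized. *)
Lemma testfun_mean1 (a b : R) : 0 < a -> a < b -> b < 1 -> exists rho,
  [/\ testfun rho, forall x, 0 <= rho x, forall x, ~ (a < x < b) -> rho x = 0 &
      \int[mu]_x rho x = 1].
Proof.
move=> a0 ab b1.
have cv : \int[mu]_x bump_seq a b n x @[n --> \oo] --> \int[mu]_x (\1_`]a, b[ x : R).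
  apply: (Rint_dct _ _ (cst 1)).
  - by move=> n; exact: smooth_measurable (smooth_bump_seq _ _ _).
  - exact: measurable_indic.
  - apply: Linfty_Lp => //; apply: (Lfun_bounded _ 1) => //.
    by apply: nearW => x; rewrite normr1.
  - apply: nearW => x n; have /andP[b0 b1'] := bump_seq_itv a b n x.
    by rewrite ger0_norm.
  - by apply: nearW => x; exact: bump_seq_cvg.
have I : \int[mu]_x (\1_`]a, b[ x : R) = b - a.
  rewrite /Rintegral integral_indic//= setIT leb01_in; last first.
    move=> x /=; rewrite !in_itv/= => /andP[ax xb].
    by rewrite (lt_trans a0 ax) (lt_trans xb b1).
  by rewrite lebesgue_measure_itv/= lte_fin ab.
rewrite I in cv.
have /cvgrPdist_lt/(_ (b - a)) := cv.
rewrite subr_gt0 => /(_ ab) [N _ /(_ N (leqnn N))] /= hN.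
set m := \int[mu]_x bump_seq a b N x in hN.
have m0 : 0 < m.
  move: hN; rewrite ltr_norml => /andP[_].
  by rewrite ltrBlDr -ltrBlDl subrr.
have tb := testfun_bump_seq a b N a0 b1.
exists (fun x => m^-1 * bump_seq a b N x); split.
- exact: testfunZ.
- move=> x; rewrite mulr_ge0 ?invr_ge0 ?(ltW m0)//.
  by have /andP[] := bump_seq_itv a b N x.
- by move=> x hx; rewrite bump_seq_out// mulr0.
- by rewrite (RintZ _ _ (testfun_L1 _ tb)) mulVf// gt_eqF.
Qed.

(** The function psi = f - (int f) rho has zero mean, so that its primitive is a test
    function to which the definition of the weak derivative of v applies.  The
    right-hand side is the error due to rho. *)
Lemma parts_split f rho v : sobolevH1 v -> testfun f -> testfun rho ->
  \int[mu]_x rho x = 1 ->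
  \int[mu]_x (v x * f x) + \int[mu]_x (wderiv v x * prim f x) =
  (\int[mu]_x f x) *
    (\int[mu]_x (v x * rho x) + \int[mu]_x (wderiv v x * prim rho x)).
Proof.
move=> hv tf tr r1; have [w2 ww] := wderivP _ hv.
have v1 : v \in Lfun mu 1%E by apply: L2_L1; case: hv.
have f1 := testfun_L1 _ tf; have rho1 := testfun_L1 _ tr.
set c := \int[mu]_x f x.
pose psi := fun x => (- c) * rho x + f x.
have tpsi : testfun psi by exact: testfunD (testfunZ (- c) _ tr) tf.
have psi0 : \int[mu]_x psi x = 0.
  rewrite (RintD _ _ (LfunZ (- c) _ _ (lexx 1) rho1) f1) (RintZ _ _ rho1) r1.
  by rewrite mulr1 addNr.
have tG := prim_testfun _ tpsi psi0.
have := ww _ tG.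
have -> : derive1 (prim psi) = psi.
  by apply/funext => x; have [] := prim_derive _ x tpsi.
have L1M u g : u \in Lfun mu 1%E -> testfun g -> (fun x => u x * g x) \in Lfun mu 1%E.
  by move=> u1 tg; exact: LfunM_testfun (lexx 1) u1 tg.
have L1P g : g \in Lfun mu 1%E -> (fun x => wderiv v x * prim g x) \in Lfun mu 1%E.
  by move=> g1; exact: LfunM2 w2 (primL2 _ g1).
have -> : \int[mu]_x (v x * psi x) =
    - c * \int[mu]_x (v x * rho x) + \int[mu]_x (v x * f x).
  have vr1 := L1M _ _ v1 tr.
  rewrite -(RintZ _ _ vr1) -(RintD _ _ (LfunZ _ _ _ (lexx 1) vr1) (L1M _ _ v1 tf)).
  by apply: eq_Rintegral => x _; rewrite /psi mulrDr mulrCA.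
have -> : \int[mu]_x (wderiv v x * prim psi x) =
    - c * \int[mu]_x (wderiv v x * prim rho x) + \int[mu]_x (wderiv v x * prim f x).
  have vr1 := L1P _ rho1.
  rewrite -(RintZ _ _ vr1) -(RintD _ _ (LfunZ _ _ _ (lexx 1) vr1) (L1P _ f1)).
  apply: eq_Rintegral => x _; rewrite (prim_linear (- c) rho f)//.
  by rewrite mulrDr mulrCA.
have solve (p q y z : R) : - c * p + y = - (- c * q + z) -> y + z = c * (p + q).
  by move=> h; lra.
exact: solve.
Qed.

(** In [parts_split] let rho have mass 1 and support tending to 1.  Then int v rho
    tends to v(1) = 0 by continuity, and prim rho tends to 0 on (0,1) while staying
    bounded by 1. *)
Lemma sobolevH_parts f v : sobolevH v -> testfun f ->
  \int[mu]_x (f x * v x) = - \int[mu]_x (prim f x * wderiv v x).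
Proof.
move=> [hv [U [cU vU U1]]] tf; have [w2 _] := wderivP _ hv.
have v1 : v \in Lfun mu 1%E by apply: L2_L1; case: hv.
(* The support of rho n lies in [a n, a n.+1], with 0 < a n < 1 and a n -> 1. *)
pose a n : R := 1 - n.+2%:R^-1.
have a0 n : 0 < a n by rewrite subr_gt0 invf_lt1 ?ltr0n// ltr1n.
have aS n : a n < a n.+1 by rewrite ltrD2l ltrN2 ltf_pV2 ?posrE ?ltr0n// ltr_nat.
have a1 n : a n < 1 by rewrite gtrBl invr_gt0 ltr0n.
have cva : a n @[n --> \oo] --> (1 : R).
  rewrite -[X in _ --> X]subr0; apply: cvgB; first exact: cvg_cst.
  by have := @cvg_harmonic R; rewrite -cvg_shiftS.
have [rho hrho] := choice (fun n => testfun_mean1 (a n) (a n.+1) (a0 n) (aS n) (a1 n.+1)).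
have tr n : testfun (rho n) by case: (hrho n).
have r0 n x : 0 <= rho n x by case: (hrho n).
have rout n x : x <= a n -> rho n x = 0.
  by move=> xa; case: (hrho n) => _ _ h _; apply: h; rewrite ltNge xa.
have r1 n : \int[mu]_x rho n x = 1 by case: (hrho n).
have rL n := testfun_L1 _ (tr n).
suff : \int[mu]_x (v x * f x) + \int[mu]_x (wderiv v x * prim f x) = 0.
  move/eqP; rewrite addr_eq0 => /eqP h.
  under eq_Rintegral do rewrite mulrC.
  rewrite h; congr (- _).
  by apply: eq_Rintegral => x _; rewrite mulrC.
have cvv : \int[mu]_x (v x * rho n x) @[n --> \oo] --> (0 : R).
  have cU1 : U x @[x --> 1^'-] --> (0 : R).
    by have /(continuous_within_itvP _ ltr01)[_ _] := cU; rewrite U1.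
  apply/cvgr0Pnorm_le => e e0.
  have : \forall x \near 1^'-, `|U x| <= e by move/cvgr0Pnorm_le : cU1; apply.
  move=> [d /= d0 hd].
  have : \forall n \near \oo, `|1 - a n| < d by move/cvgrPdist_lt : cva; apply.
  apply: filterS => n; rewrite gtr0_norm ?subr_gt0// => nd.
  have vr1 := LfunM_testfun _ _ _ (lexx 1) v1 (tr n).
  apply: le_trans (le_normr_Rintegral _ (L1_integrable _ vr1)) _ => //.
  rewrite -[leRHS]mulr1 -(r1 n) -(RintZ _ _ (rL n)).
  have er1 := LfunZ e _ _ (lexx 1) (rL n).
  apply: (le_Rint_ae (fun x => `|v x * rho n x|)) => //; first exact: Lfun_norm vr1.
  move: vU (@ae_leb01_itv R); apply: filterS2 => x vUx /andP[x0 x1].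
  rewrite normrM (ger0_norm (r0 n x)).
  have [xa|ax] := leP x (a n); first by rewrite rout// !mulr0.
  apply: ler_wpM2r => //; rewrite vUx; apply: hd => //=.
  rewrite gtr0_norm ?subr_gt0//; apply: lt_trans nd.
  by rewrite ltrD2l ltrN2.
have cvw : \int[mu]_x (wderiv v x * prim (rho n) x) @[n --> \oo] --> (0 : R).
  have -> : (0 : R) = \int[mu]_x (cst 0 x) by rewrite Rintegral_cst// mul0r.
  apply: (Rint_dct _ _ (fun x => `|wderiv v x|)).
  - move=> n; apply: measurable_funM; first exact: Lfun_measurable w2.
    exact: prim_measurable.
  - exact: measurable_cst.
  - exact: Lfun_norm (L2_L1 _ w2).
  - apply: nearW => x n; rewrite normrM ler_piMr//.
    apply: le_trans (prim_norm_le _ _ (rL n)) _.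
    have -> : \int[mu]_t `|rho n t| = \int[mu]_t rho n t.
      by apply: eq_Rintegral => y _; rewrite ger0_norm.
    by rewrite r1.
  - move: (@ae_leb01_itv R); apply: filterS => x /andP[x0 x1].
    apply: cvg_near_cst.
    have : \forall n \near \oo, `|1 - a n| < 1 - x.
      by move/cvgrPdist_lt : cva; apply; rewrite subr_gt0.
    apply: filterS => n; rewrite gtr0_norm ?subr_gt0// ltrD2l ltrN2 => xa.
    rewrite (prim_testfun_eq0 _ (a n)) ?mulr0// => t /negP; rewrite -ltNge => ta.
    by rewrite rout// ltW.
set c := LHS.
have cv : (\int[mu]_x f x) * (\int[mu]_x (v x * rho n x) +
    \int[mu]_x (wderiv v x * prim (rho n) x)) @[n --> \oo] --> (0 : R).
  have := cvgM (cvg_cst (\int[mu]_x f x)) (cvgD cvv cvw).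
  by rewrite addr0 mulr0; apply.
have {}cv : c @[n --> \oo] --> (0 : R).
  move: cv; apply: cvg_trans; apply: near_eq_cvg; apply: nearW => n.
  by rewrite /c (parts_split f (rho n)).
by rewrite -(cvg_lim _ cv)// lim_cst.
Qed.

End SobolevH.

(** * Resolvents *)

Section Resolvent.
Context {R : realType}.
Implicit Types (f g h phi sigma u v : R -> R) (x : R).
Local Notation mu := (@leb01 R).

(** The inverse is written by a real power, which is measurable; at 0 both sides
    vanish. *)
Lemma measurable_inv : measurable_fun [set: R] (@GRing.inv R).
Proof.
have -> : @GRing.inv R = (fun x => x * (`|x| `^ (- 1)) ^+ 2).
  apply/funext => x; rewrite powR_inv1//.
  have [->|x0] := eqVneq x 0; first by rewrite mul0r invr0.
  rewrite exprVn -normrX ger0_norm ?sqr_ge0//.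
  by rewrite expr2 invfM mulrA mulfV// mul1r.
apply: measurable_funM => //; apply: measurable_funX.
apply: (@measurableT_comp _ _ _ _ _ _ (fun x : R => x `^ (- 1))) => //.
Qed.

Lemma dualH_pairing f : testfun f -> dualH (pairing f).
Proof.
move=> tf; have f2 : f \in Lfun mu 2%:E by apply: testfun_Lfun; rewrite ?lee1n.
split.
  move=> a u v [[u2 _] _] [[v2 _] _]; rewrite /pairing.
  have fu1 := LfunM2 _ _ f2 u2; have fv1 := LfunM2 _ _ f2 v2.
  rewrite -(RintZ a _ fu1) -(RintD _ _ (LfunZ a _ _ (lexx 1) fu1) fv1).
  by apply: eq_Rintegral => x _ /=; rewrite mulrDr mulrCA.
have p2 := primL2 _ (testfun_L1 _ tf).
exists (fine 'N[mu]_(2%:E)[EFin \o prim f]) => v hv.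
have [w2 _] := wderivP _ hv.1.
have pw1 := LfunM2 _ _ p2 w2.
rewrite /pairing sobolevH_parts// normrN.
have [mp Np] := (LfunE _ _).1 p2; have [mw _] := (LfunE _ _).1 w2.
rewrite fineK; last by rewrite ge0_fin_numE ?Lnorm_ge0.
apply: (@le_trans _ _ 'N[mu]_1[EFin \o (prim f \* wderiv v)%R]%E).
  rewrite EFin_normr_Rintegral//; last exact: L1_integrable.
  rewrite Lnorm1; apply: le_abse_integral => //.
  by apply/measurable_EFinP; exact: Lfun_measurable pw1.
by apply: hoelder => //; rewrite [RHS]splitr !div1r.
Qed.

(** Existence: the primitive of - prim f / sigma that vanishes at 1 solves the
    problem.  Uniqueness: the equation, tested with the primitives of test functions,
    says that sigma u_x + prim f is orthogonal to all test functions. *)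
Lemma pairing_resolvent (sigma0 sigma1 : R) sigma f :
  0 < sigma0 -> Sigma0 sigma0 sigma1 sigma -> testfun f ->
  sobolevH (resolvent sigma (pairing f)) /\
  {ae mu, forall x, wderiv (resolvent sigma (pairing f)) x = - (prim f x / sigma x)}.
Proof.
move=> s0 [soo hs] tf; have f1 := testfun_L1 _ tf; have p2 := primL2 _ f1.
have ms := Lfun_measurable _ _ soo.
have mp := prim_measurable _ f1.
have mwp h : h \in Lfun mu 2%:E -> wderiv (fun x => prim h x - prim h 1) \in Lfun mu 2%:E.
  by move=> h2; have [] := wderiv_prim h (- prim h 1) h2.
have sL2 h : h \in Lfun mu 2%:E -> (sigma \* h) \in Lfun mu 2%:E.
  move=> h2; apply: (LfunM_bounded _ _ 2 sigma1) => //; first by rewrite ler1n.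
  move: hs; apply: filterS => x /andP[a b].
  by rewrite ger0_norm// (le_trans _ a)// ltW.
pose Q := [set u | [/\ dualH (pairing f), sobolevH u & forall v, sobolevH v ->
  \int[mu]_x (sigma x * wderiv u x * wderiv v x) = pairing f v]].
have [hd hu hw] : Q (resolvent sigma (pairing f)).
  apply: getPex.
  pose h := fun x => - (prim f x / sigma x).
  have mh : measurable_fun [set: R] h.
    apply: measurableT_comp => //; apply: measurable_funM => //.
    exact: measurableT_comp measurable_inv ms.
  have h2 : h \in Lfun mu 2%:E.
    apply: (Lfun_le _ (fun x => sigma0^-1 * prim f x)) => //.
    - by rewrite ler1n.
    - by apply: LfunZ => //; rewrite ler1n.
    - move: hs; apply: filterS => x /andP[a b].
      have sx : 0 < sigma x by rewrite (lt_le_trans s0).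
      rewrite normrN !normrM mulrC ler_wpM2r// !gtr0_norm ?invr_gt0//.
      by rewrite lef_pV2// posrE.
  exists (fun x => prim h x - prim h 1); split.
  - exact: dualH_pairing.
  - exact: sobolevH_prim.
  move=> v hv; rewrite /pairing (sobolevH_parts _ _ hv tf).
  have [w2 _] := wderivP _ hv.1.
  have pw1 := LfunM2 _ _ p2 w2.
  transitivity (\int[mu]_x (-1 * (prim f x * wderiv v x))); last first.
    by rewrite (RintZ (-1) _ pw1) mulN1r.
  apply: Rint_ae_eq.
  - exact: Lfun_measurable (LfunM2 _ _ (sL2 _ (mwp _ h2)) w2).
  - exact: Lfun_measurable (LfunZ (-1) _ _ (lexx 1) pw1).
  - have [_ wE] := wderiv_prim h (- prim h 1) h2.
    move: wE hs; apply: filterS2 => x -> /andP[a b].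
    have sx : sigma x != 0 by rewrite gt_eqF// (lt_le_trans s0).
    by rewrite /h mulrN mulrCA mulfV// mulr1 mulN1r mulNr.
split => //; move: (resolvent _ _) hu hw => u hu hw {Q hd}.
have [wu2 _] := wderivP _ hu.1.
pose k := (sigma \* wderiv u) \+ prim f.
have k2 : k \in Lfun mu 2%:E by apply: LfunD; rewrite ?lee1n//; exact: sL2.
have k0 : {ae mu, forall x, k x = 0}.
  apply: fundamental_eq0; first exact: L2_L1.
  move=> phi tphi.
  have phi2 : phi \in Lfun mu 2%:E by apply: testfun_Lfun; rewrite ?lee1n.
  have hv := sobolevH_prim _ phi2.
  have [w2 wE] := wderiv_prim phi (- prim phi 1) phi2.
  have := hw _ hv; rewrite /pairing (sobolevH_parts _ _ hv tf).
  set w := wderiv (fun x => prim phi x - prim phi 1) in w2 wE *.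
  have sw1 := LfunM2 _ _ (sL2 _ wu2) w2; have pw1 := LfunM2 _ _ p2 w2.
  move/eqP; rewrite -addr_eq0 -(RintD _ _ sw1 pw1) => /eqP <-.
  apply: Rint_ae_eq.
  - exact: Lfun_measurable (LfunM2 _ _ k2 phi2).
  - exact: Lfun_measurable (LfunD _ _ _ (lexx 1%E) sw1 pw1).
  - by move: wE; apply: filterS => x wx; rewrite /k /= wx mulrDl.
move: k0 hs; apply: filterS2 => x; rewrite /k /= => kx /andP[a b].
have sx : sigma x != 0 by rewrite gt_eqF// (lt_le_trans s0).
by move/eqP: kx; rewrite addr_eq0 => /eqP/(congr1 (fun y => y / sigma x));
  rewrite mulrAC mulfV// mul1r mulNr.
Qed.

Lemma weak_derivativeB u v g h : u \in Lfun mu 2%:E -> v \in Lfun mu 2%:E ->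
  g \in Lfun mu 2%:E -> h \in Lfun mu 2%:E ->
  weak_derivative u g -> weak_derivative v h -> weak_derivative (u \- v) (g \- h).
Proof.
move=> /L2_L1 u1 /L2_L1 v1 /L2_L1 g1 /L2_L1 h1 wu wv phi tphi.
have LM w psi : w \in Lfun mu 1%E -> testfun psi ->
    (fun x => w x * psi x) \in Lfun mu 1%E.
  by move=> w1 tpsi; exact: LfunM_testfun.
have tdphi := testfun_derive1 _ tphi.
under eq_Rintegral do rewrite /= mulrBl.
rewrite (RintB _ _ (LM _ _ u1 tdphi) (LM _ _ v1 tdphi)) wu// wv//.
under [in RHS]eq_Rintegral do rewrite /= mulrBl.
by rewrite (RintB _ _ (LM _ _ g1 tphi) (LM _ _ h1 tphi)) opprB opprK addrC.
Qed.

Lemma wderiv_resolventB (sigma0 sigma1 : R) sigma sigmat f :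
  0 < sigma0 -> Sigma0 sigma0 sigma1 sigma -> Sigma0 sigma0 sigma1 sigmat ->
  testfun f ->
  let Tf := wderiv (resolvent sigma (pairing f) \- resolvent sigmat (pairing f)) in
  Tf \in Lfun mu 1%E /\
  {ae mu, forall x, Tf x = ((sigmat x)^-1 - (sigma x)^-1) * prim f x}.
Proof.
move=> s0 hs hst tf /=.
have [hu uE] := pairing_resolvent _ _ _ _ s0 hs tf.
have [hv vE] := pairing_resolvent _ _ _ _ s0 hst tf.
move: (resolvent sigma _) (resolvent sigmat _) hu uE hv vE => u v hu uE hv vE.
have [wu2 wwu] := wderivP _ hu.1; have [wv2 wwv] := wderivP _ hv.1.
have ww2 : (wderiv u \- wderiv v) \in Lfun mu 2%:E.
  by apply: LfunB; rewrite ?lee1n.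
have [w2 wE] := wderiv_ae (u \- v) _ ww2
  (weak_derivativeB _ _ _ _ hu.1.1 hv.1.1 wu2 wv2 wwu wwv).
split; first exact: L2_L1.
move: wE uE vE; apply: filterS3 => x wx ux vx; rewrite wx /= ux vx.
by rewrite opprK; ring.
Qed.

End Resolvent.

(** * Norms of multiplication operators on W^{-1,1} *)

Section OperatorNorm.
Context {R : realType}.
Implicit Types (f g h phi u v : R -> R) (x : R) (s : nat -> R -> R).
Local Notation mu := (@leb01 R).
Local Notation lam := (@lebesgue_measure R).
Local Notation N1 f := ('N[mu]_1[EFin \o f]%E).

Lemma normWE f : testfun f -> normW f = N1 (prim f).
Proof.
move=> tf; rewrite /normW; congr (Lnorm _ _ (EFin \o _)); apply/funext => x.
rewrite /prim testfun_restr01// Rintegral_mkcond [RHS]Rintegral_mkcond.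
apply: eq_Rintegral => t _; rewrite !patchE.
have [t0|t0] := leP t 0.
  by rewrite (testfun_out f t tf) ?if_same// ltNge t0.
congr (if _ then _ else _); apply/idP/idP; rewrite !inE/= !in_itv/= ?(ltW t0)//.
Qed.

Lemma N1E f : f \in Lfun mu 1%E -> N1 f = (\int[mu]_x `|f x|)%:E.
Proof.
move=> f1; rewrite /Rintegral fineK ?Lnorm1//.
by apply: integrable_fin_num => //; exact: L1_integrable (Lfun_norm f1).
Qed.

Lemma prim_L1 f : testfun f -> prim f \in Lfun mu 1%E.
Proof. by move=> tf; apply: L2_L1; apply: primL2; exact: testfun_L1. Qed.

Lemma primB_testfun f g : testfun f -> testfun g -> prim (f \- g) = prim f \- prim g.
Proof.
move=> tf tg; apply/funext => x; have f1 := testfun_L1 _ tf; have g1 := testfun_L1 _ tg.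
have -> : f \- g = (fun t => -1 * g t + f t).
  by apply/funext => t /=; rewrite mulN1r addrC.
by rewrite prim_linear//= mulN1r addrC.
Qed.

Lemma normW_real f : testfun f -> normW f = (\int[mu]_x `|prim f x|)%:E.
Proof. by move=> tf; rewrite normWE// N1E//; exact: prim_L1. Qed.

(** The triangle inequality for the W^{-1,1} norm, in the form that makes the norms
    of a Cauchy sequence a Cauchy sequence of reals. *)
Lemma normW_dist f g : testfun f -> testfun g ->
  (`| \int[mu]_x `|prim f x| - \int[mu]_x `|prim g x| |%:E <= normW (f \- g)%R)%E.
Proof.
move=> tf tg; have f1 := prim_L1 _ tf; have g1 := prim_L1 _ tg.
have n h : h \in Lfun mu 1%E -> (fun x => `|h x|) \in Lfun mu 1%E by exact: Lfun_norm.
have fg1 := LfunB _ _ _ (lexx 1%E) f1 g1.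
rewrite normWE; last exact: testfunB.
rewrite primB_testfun// N1E// lee_fin -(RintB _ _ (n _ f1) (n _ g1)).
apply: le_trans (le_normr_Rintegral _ (L1_integrable _ (LfunB _ _ _ (lexx 1%E) (n _ f1) (n _ g1)))) _ => //.
apply: le_Rint_ae; [exact: n (LfunB _ _ _ (lexx 1%E) (n _ f1) (n _ g1))|exact: n|].
by apply: nearW => x; exact: ler_dist_dist.
Qed.

Lemma cvg_normW s : cauchyW s -> exists r : R,
  \int[mu]_x `|prim (s n) x| @[n --> \oo] --> r.
Proof.
move=> [ts cs].
suff : cvgn (fun n => \int[mu]_x `|prim (s n) x|) by move=> /cvg_ex.
apply/cauchy_cvgP/cauchy_exP => e e0.
have [N hN] := cs e e0; exists (\int[mu]_x `|prim (s N) x|).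
exists N => // n /= Nn; rewrite -ball_normE /=.
rewrite -lte_fin; apply: le_lt_trans (hN N n (leqnn N) Nn).
exact: normW_dist.
Qed.

Lemma cvg_normW_class s s' (r : R) : cauchyW s -> classW s s' ->
  \int[mu]_x `|prim (s n) x| @[n --> \oo] --> r ->
  normW (s' n) @[n --> \oo] --> r%:E.
Proof.
move=> [ts _] [[ts' _] h] hr.
have -> : (fun n => normW (s' n)) = (fun n => (\int[mu]_x `|prim (s' n) x|)%:E).
  by apply/funext => n; rewrite normW_real.
apply: cvg_EFin; first exact: nearW.
have -> : fine \o (fun n => (\int[mu]_x `|prim (s' n) x|)%:E) =
    (fun n => (\int[mu]_x `|prim (s' n) x| - \int[mu]_x `|prim (s n) x|) +
      \int[mu]_x `|prim (s n) x|).
  by apply/funext => n /=; rewrite subrK.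
rewrite -[X in _ --> X]add0r; apply: cvgD => //.
apply/cvgr0Pnorm_le => e e0.
have hf : fine (normW (s' n \- s n)%R) @[n --> \oo] --> (0 : R) by exact: fine_cvg h.
move/cvgr0Pnorm_le : hf => /(_ e e0).
apply: filterS => n; have := normW_dist _ _ (ts' n) (ts n).
rewrite normW_real; last exact: testfunB.
by rewrite lee_fin /= => hd /(le_trans (ler_norm _)); exact: le_trans hd.
Qed.

Lemma normW_subrr f : normW (f \- f)%R = 0%E.
Proof.
have -> : f \- f = cst 0 by apply/funext => x /=; rewrite subrr.
rewrite /normW (_ : (fun _ => _) = cst (0 : R)); last first.
  by apply/funext => x; rewrite Rintegral_cst// mul0r.
by rewrite Lnorm0.
Qed.

Lemma classW_refl s : cauchyW s -> classW s s.
Proof.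
move=> cs; split => //; have -> : (fun n => normW (s n \- s n)%R) = cst 0%E.
  by apply/funext => n; exact: normW_subrr.
exact: cvg_cst.
Qed.

(** All representatives of a class have the same limit of norms, which identifies
    [W11norm]. *)
Lemma W11normP s : cauchyW s -> exists r : R,
  [/\ W11norm (classW s) = r%:E &
    forall s', classW s s' -> normW (s' n) @[n --> \oo] --> r%:E].
Proof.
move=> cs; have [r hr] := cvg_normW _ cs.
have h s' : classW s s' -> normW (s' n) @[n --> \oo] --> r%:E.
  by move=> ss'; exact: cvg_normW_class cs ss' hr.
exists r; split => //.
have hg : forall s', classW s s' -> normW (s' n) @[n --> \oo] --> W11norm (classW s).
  by apply: (@getPex _ [set r : \bar R | forall s', classW s s' ->
    normW (s' n) @[n --> \oo] --> r]); exists r%:E.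
have sr := classW_refl _ cs.
exact: cvg_unique (hg _ sr) (h _ sr).
Qed.

Section Multiplication.
Variables (m : R -> R) (M : R) (T : (R -> R) -> R -> R).
Hypothesis (mM : {ae mu, forall x, `|m x| <= M}).
Hypothesis (T1 : forall f, testfun f -> T f \in Lfun mu 1%E).
Hypothesis (Tm : forall f, testfun f -> {ae mu, forall x, T f x = m x * prim f x}).

Lemma M_ge0 : 0 <= M.
Proof.
rewrite leNgt; apply/negP => M0.
have [N [mN N0 hN]] := mM.
suff : (mu [set: R] <= 0)%E by rewrite leb01T lee_fin ler10.
rewrite -N0; apply: le_measure; rewrite ?inE//.
move=> x _; apply: hN => /= h.
by have := le_lt_trans h M0; rewrite normr_lt0.
Qed.

Lemma N1_TB f g : testfun f -> testfun g ->
  (N1 (T f \- T g)%R <= M%:E * normW (f \- g)%R)%E.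
Proof.
move=> tf tg; have f1 := prim_L1 _ tf; have g1 := prim_L1 _ tg.
have tfg := testfunB _ _ tf tg; have fg1 := prim_L1 _ tfg.
rewrite normW_real// (N1E _ (LfunB _ _ _ (lexx 1%E) (T1 _ tf) (T1 _ tg))).
rewrite -EFinM lee_fin -(RintZ _ _ (Lfun_norm fg1)).
apply: le_Rint_ae.
- exact: Lfun_norm (LfunB _ _ _ (lexx 1%E) (T1 _ tf) (T1 _ tg)).
- exact: LfunZ (Lfun_norm fg1).
move: mM (Tm _ tf) (Tm _ tg); apply: filterS3 => x hM hf hg.
by rewrite /= hf hg -mulrBr normrM primB_testfun// ler_wpM2r.
Qed.

Lemma N1_T f : testfun f -> (N1 (T f) <= M%:E * normW f)%E.
Proof.
move=> tf; have f1 := prim_L1 _ tf.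
rewrite normW_real// (N1E _ (T1 _ tf)) -EFinM lee_fin -(RintZ _ _ (Lfun_norm f1)).
apply: le_Rint_ae; [exact: Lfun_norm (T1 _ tf)|exact: LfunZ (Lfun_norm f1)|].
move: mM (Tm _ tf); apply: filterS2 => x hM hf.
by rewrite hf normrM ler_wpM2r.
Qed.

Lemma N1_triangle f g : f \in Lfun mu 1%E -> g \in Lfun mu 1%E ->
  (N1 g <= N1 f + N1 (f \- g)%R)%E.
Proof.
move=> f1 g1; have fg1 := LfunB _ _ _ (lexx 1%E) f1 g1.
rewrite !N1E// -EFinD lee_fin -(RintD _ _ (Lfun_norm f1) (Lfun_norm fg1)).
apply: le_Rint_ae; [exact: Lfun_norm g1|exact: LfunD (Lfun_norm f1) (Lfun_norm fg1)|].
apply: nearW => x /=; rewrite -lerBlDl -[leRHS]normrN opprB; exact: lerB_dist.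
Qed.

Lemma N1_triangle' f g : f \in Lfun mu 1%E -> g \in Lfun mu 1%E ->
  (N1 f <= N1 g + N1 (f \- g)%R)%E.
Proof.
move=> f1 g1; have fg1 := LfunB _ _ _ (lexx 1%E) f1 g1.
rewrite !N1E// -EFinD lee_fin -(RintD _ _ (Lfun_norm g1) (Lfun_norm fg1)).
apply: le_Rint_ae; [exact: Lfun_norm f1|exact: LfunD (Lfun_norm g1) (Lfun_norm fg1)|].
apply: nearW => x /=; rewrite -lerBlDl; exact: lerB_dist.
Qed.

(** The bound for test functions passes to the limit along a representative. *)
Lemma opnormW_le : (opnormW T <= M%:E)%E.
Proof.
apply: ge_ereal_sup => _ [w [[s cs <-] hn] <-].
have [r [Er hr]] := W11normP _ cs; rewrite Er lee_fin in hn.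
pose P := [set g | g \in Lfun mu 1%E /\ forall s', classW s s' ->
    N1 (T (s' n) \- g)%R @[n --> \oo] --> 0%E].
(* If T s had no limit in L^1, [extW] would be its default value, the zero
   function. *)
have [ex|nex] := pselect (exists g, P g); last first.
  have -> : extW T (classW s) = cst 0.
    by apply: getPN => g Pg; apply: nex; exists g.
  by rewrite Lnorm0// lee_fin M_ge0.
have [g1 hg] : P (extW T (classW s)) := getPex ex.
move: (extW _ _) g1 hg => g g1 hg {ex}.
have cs0 := classW_refl _ cs.
have cv : (M%:E * normW (s n) + N1 (T (s n) \- g)%R)%E @[n --> \oo] -->
    (M%:E * r%:E + 0)%E.
  apply: cvgeD => //; last exact: hg.
  by apply: cvgeZl => //; exact: hr.
apply: (@le_trans _ _ (M%:E * r%:E + 0)%E).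
  rewrite -(cvg_lim _ cv)//; apply: lime_ge; first by apply/cvg_ex; eexists; exact: cv.
  apply: nearW => n; have ts := cs.1 n.
  apply: le_trans (N1_triangle _ _ (T1 _ ts) g1) _.
  by rewrite leeD2r// N1_T.
by rewrite adde0 -EFinM lee_fin ler_piMr// M_ge0.
Qed.

(** A test function defines an element of W^{-1,1}, the class of a constant
    sequence, on which the extension of T is T f up to a null set. *)
Lemma opnormW_ge f : testfun f -> (normW f <= 1)%E -> (N1 (T f) <= opnormW T)%E.
Proof.
move=> tf nf.
have cs : cauchyW (fun _ : nat => f).
  by split => // e e0; exists 0%N => _ _ _ _; rewrite normW_subrr lte_fin.
have cs0 := classW_refl _ cs.
set w := classW _ in cs0.
have [r [Er hr]] := W11normP _ cs.
have rE : normW f = r%:E.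
  exact: cvg_unique (cvg_cst _) (hr _ cs0).
pose P := [set g | g \in Lfun mu 1%E /\ forall s', w s' ->
    N1 (T (s' n) \- g)%R @[n --> \oo] --> 0%E].
have [g1 hg] : P (extW T w).
  apply: getPex; exists (T f); split; first exact: T1.
  move=> s' [[ts' _] hs'].
  have up : (M%:E * normW (s' n \- f)%R)%E @[n --> \oo] --> 0%E.
    by rewrite -(mule0 M%:E); apply: cvgeZl => //; exact: hs'.
  apply: squeeze_cvge up; last exact: cvg_cst.
  by apply: nearW => n; rewrite Lnorm_ge0 N1_TB.
have g0 : N1 (T f \- extW T w)%R = 0%E.
  exact: cvg_unique (cvg_cst _) (hg _ cs0).
apply: le_trans (N1_triangle' _ _ (T1 _ tf) g1) _.
rewrite g0 adde0; apply: ereal_sup_ubound; exists w => //; split.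
  by exists (fun=> f).
by rewrite Er -rE.
Qed.

End Multiplication.

(** If c bounds the operator norm, then int |m| phi <= c int phi for every test
    function phi >= 0: apply the bound to f = phi' / int phi, whose primitive is
    phi / int phi and whose norm is 1. *)
Lemma opnormW_multiplication m T : m \in Lfun mu +oo%E ->
  (forall f, testfun f -> T f \in Lfun mu 1%E) ->
  (forall f, testfun f -> {ae mu, forall x, T f x = m x * prim f x}) ->
  opnormW T = 'N[mu]_+oo[EFin \o m]%E.
Proof.
move=> moo T1 Tm.
have Nfin : 'N[mu]_+oo[EFin \o m]%E \is a fin_num.
  by have [_ h] := (LfunE _ _).1 moo; rewrite ge0_fin_numE ?Lnorm_ge0.
have [M NM] : exists M : R, 'N[mu]_+oo[EFin \o m]%E = M%:E.
  by exists (fine 'N[mu]_+oo[EFin \o m]%E); rewrite fineK.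
have mM : {ae mu, forall x, `|m x| <= M} by apply/ae_abs_le_Linfty; rewrite NM.
apply/eqP; rewrite eq_le; apply/andP; split.
  by rewrite NM; exact: (opnormW_le m).
have tf0 : testfun (cst 0 : R -> R).
  split; first exact: smooth_cst.
  by exists 2^-1, 2^-1; split => //; rewrite ?invr_gt0// invf_lt1// ltr1n.
have ge := opnormW_ge m M T mM T1 Tm.
have op0 : (0 <= opnormW T)%E.
  apply: le_trans (ge _ tf0 _); first exact: Lnorm_ge0.
  rewrite normW_real//; rewrite lee_fin.
  have -> : (fun x => `|prim (cst 0 : R -> R) x|) = cst 0.
    apply/funext => x; rewrite primE; last exact: testfun_L1.
    by rewrite Rintegral_cst// mul0r normr0.
  by rewrite Rintegral_cst// mul0r.
case: (opnormW T) op0 ge => [c|_ _|//]; last by rewrite leey.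
rewrite lee_fin => c0 ge; apply/ae_abs_le_Linfty.
have m1 : m \in Lfun mu 1%E by exact: Linfty_Lp.
have c1 : (cst c : R -> R) \in Lfun mu 1%E.
  apply: Linfty_Lp => //; apply: (Lfun_bounded _ `|c|) => //.
  exact: nearW.
have cm1 := LfunB _ _ _ (lexx 1%E) c1 (Lfun_norm m1).
have : {ae mu, forall x, 0 <= c - `|m x|}; last first.
  by apply: filterS => x /=; rewrite subr_ge0.
apply: fundamental_ge0 => // phi tphi phi0.
have p1 := testfun_L1 _ tphi.
have mp1 := LfunM_testfun _ _ _ (lexx 1) (Lfun_norm m1) tphi.
have -> : \int[mu]_x ((c - `|m x|) * phi x) =
    c * \int[mu]_x phi x - \int[mu]_x (`|m x| * phi x).
  rewrite -(RintZ _ _ p1) -(RintB _ _ (LfunZ c _ _ (lexx 1) p1) mp1).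
  by apply: eq_Rintegral => x _ /=; rewrite mulrBl.
rewrite subr_ge0; set I := \int[mu]_x phi x.
have I0 : 0 <= I by apply: Rintegral_ge0.
(* When int phi = 0, phi vanishes a.e. and the inequality reads 0 <= 0. *)
have [Iz|Inz] := eqVneq I 0.
  rewrite Iz mulr0 -(mulr0 M) -Iz -(RintZ _ _ p1).
  apply: le_Rint_ae => //; first exact: LfunZ.
  by move: mM; apply: filterS => x hM; exact: ler_wpM2r.
have Ip : 0 < I by rewrite lt_neqAle eq_sym Inz.
pose f := fun x => I^-1 * derive1 phi x.
have tdphi := testfun_derive1 _ tphi.
have tf : testfun f by exact: testfunZ.
have pf x : prim f x = I^-1 * phi x.
  have z1 : (cst 0 : R -> R) \in Lfun mu 1%E by exact: testfun_L1.
  have := prim_linear I^-1 (derive1 phi) (cst 0) x (testfun_L1 _ tdphi) z1.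
  rewrite (prim_derive1 phi tphi) (primE (cst 0))// Rintegral_cst// mul0r addr0 => <-.
  by congr (prim _ x); apply/funext => t; rewrite /f addr0.
have nf : (normW f <= 1)%E.
  rewrite normW_real// lee_fin (_ : Rintegral _ _ _ = 1)//.
  transitivity (\int[mu]_x (I^-1 * phi x)); last by rewrite (RintZ _ _ p1) mulVf.
  by apply: eq_Rintegral => x _; rewrite pf ger0_norm// mulr_ge0 ?phi0// invr_ge0.
have := ge _ tf nf; rewrite (N1E _ (T1 _ tf)) lee_fin.
have -> : \int[mu]_x `|T f x| = \int[mu]_x (I^-1 * (`|m x| * phi x)).
  apply: Rint_ae_eq.
  - exact: Lfun_measurable (Lfun_norm (T1 _ tf)).
  - exact: Lfun_measurable (LfunZ I^-1 _ _ (lexx 1) mp1).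
  - move: (Tm _ tf); apply: filterS => x ->; rewrite pf normrM mulrCA.
    by rewrite [`|I^-1 * _|]ger0_norm// mulr_ge0 ?phi0// invr_ge0.
by rewrite (RintZ _ _ mp1) ler_pdivrMl// mulrC.
Qed.

End OperatorNorm.

(** * Comparison of the two L^oo norms *)

Section Comparison.
Context {R : realType}.
Implicit Types (sigma : R -> R) (x : R).
Local Notation mu := (@leb01 R).
Variables (sigma0 sigma1 : R) (sigma sigmat : R -> R).
Hypotheses (h0 : 0 < sigma0) (hs : Sigma0 sigma0 sigma1 sigma)
  (hst : Sigma0 sigma0 sigma1 sigmat).

Lemma inv_diff_bounds (s t : R) : sigma0 <= s <= sigma1 -> sigma0 <= t <= sigma1 ->
  sigma1 ^- 2 * `|t - s| <= `|t^-1 - s^-1| <= sigma0 ^- 2 * `|t - s|.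
Proof.
move=> /andP[s0 s1] /andP[t0 t1].
have sp : 0 < s by rewrite (lt_le_trans h0).
have tp : 0 < t by rewrite (lt_le_trans h0).
have h1 : 0 < sigma1 by rewrite (lt_le_trans sp).
have -> : t^-1 - s^-1 = (s - t) * (s * t)^-1.
  by field; rewrite !gt_eqF.
rewrite normrM (distrC s t) [`|(s * t)^-1|]gtr0_norm ?invr_gt0 ?mulr_gt0//.
rewrite mulrC [sigma0 ^- 2 * _]mulrC; apply/andP; split; apply: ler_wpM2l => //.
  by rewrite lef_pV2 ?posrE ?exprn_gt0 ?mulr_gt0// expr2 ler_pM// ltW.
by rewrite lef_pV2 ?posrE ?exprn_gt0 ?mulr_gt0// expr2 ler_pM// ltW.
Qed.

Let m x := (sigmat x)^-1 - (sigma x)^-1.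

Let mult_bounds : {ae mu, forall x,
  sigma1 ^- 2 * `|sigmat x - sigma x| <= `|m x| <= sigma0 ^- 2 * `|sigmat x - sigma x|}.
Proof. by move: hs.2 hst.2; apply: filterS2 => x; exact: inv_diff_bounds. Qed.

Lemma Linfty_diff : (sigmat \- sigma) \in Lfun mu +oo%E.
Proof. by apply: LfunB; [rewrite leey|exact: hst.1|exact: hs.1]. Qed.

Lemma Linfty_fin f : f \in Lfun mu +oo%E -> exists d : R, 'N[mu]_+oo[EFin \o f]%E = d%:E.
Proof.
move=> /LfunE[_ h]; exists (fine 'N[mu]_+oo[EFin \o f]%E).
by rewrite fineK// ge0_fin_numE ?Lnorm_ge0.
Qed.

Lemma Linfty_inv_diff : m \in Lfun mu +oo%E.
Proof.
have [d hd] := Linfty_fin _ Linfty_diff.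
have : {ae mu, forall x, `|(sigmat \- sigma) x| <= d} by apply/ae_abs_le_Linfty; rewrite hd.
move=> hdd; apply: (Lfun_bounded _ (sigma0 ^- 2 * d)).
  have mV s : Sigma0 sigma0 sigma1 s -> measurable_fun [set: R] (fun x => (s x)^-1).
    move=> [soo _]; exact: measurableT_comp measurable_inv (Lfun_measurable _ _ soo).
  by apply: measurable_funB; exact: mV.
move: mult_bounds hdd; apply: filterS2 => x /andP[_ h] hx.
by apply: le_trans h _; rewrite ler_wpM2l// invr_ge0 exprn_ge0 ?ltW.
Qed.

Lemma Linfty_inv_diff_bounds :
  ((sigma1 ^- 2)%R%:E * 'N[mu]_+oo[EFin \o (sigmat \- sigma)%R] <=
    'N[mu]_+oo[EFin \o m] <=
    (sigma0 ^- 2)%R%:E * 'N[mu]_+oo[EFin \o (sigmat \- sigma)%R])%E.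
Proof.
have [d hd] := Linfty_fin _ Linfty_diff; have [M hM] := Linfty_fin _ Linfty_inv_diff.
rewrite hd hM -!EFinM !lee_fin; apply/andP; split; last first.
  rewrite -lee_fin -hM; apply/ae_abs_le_Linfty.
  have hdd : {ae mu, forall x, `|(sigmat \- sigma) x| <= d}.
    by apply/ae_abs_le_Linfty; rewrite hd.
  move: mult_bounds hdd; apply: filterS2 => x /andP[_ h] hx.
  by apply: le_trans h _; rewrite ler_wpM2l// invr_ge0 exprn_ge0 ?ltW.
have [s10|s10] := eqVneq sigma1 0.
  by rewrite s10 expr0n invr0 mul0r -lee_fin -hM Lnorm_ge0.
have s2 : 0 < sigma1 ^+ 2 by rewrite lt_neqAle sqr_ge0 eq_sym sqrf_eq0 s10.
rewrite ler_pdivrMl// -lee_fin -hd; apply/ae_abs_le_Linfty.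
have hmm : {ae mu, forall x, `|m x| <= M} by apply/ae_abs_le_Linfty; rewrite hM.
move: mult_bounds hmm; apply: filterS2 => x /andP[h _] hx.
by rewrite -ler_pdivrMl//; exact: le_trans h hx.
Qed.

End Comparison.

Theorem mainTheorem5 (R : realType) (sigma0 sigma1 : R)
    (h0 : 0 < sigma0) (h01 : sigma0 < sigma1)
    (sigma sigmat : R -> R)
    (hsigma : Sigma0 sigma0 sigma1 sigma)
    (hsigmat : Sigma0 sigma0 sigma1 sigmat) :
  starnorm (fun f => resolvent sigma f \- resolvent sigmat f) =
    'N[leb01]_+oo[EFin \o (fun x => (sigmat x)^-1 - (sigma x)^-1)%R]%E /\
  ((sigma1 ^- 2)%R%:E * 'N[leb01]_+oo[EFin \o (sigmat \- sigma)%R] <=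
     starnorm (fun f => resolvent sigma f \- resolvent sigmat f)%R <=
   (sigma0 ^- 2)%R%:E * 'N[leb01]_+oo[EFin \o (sigmat \- sigma)%R])%E.
Proof.
have E : starnorm (fun f => resolvent sigma f \- resolvent sigmat f) =
    'N[leb01]_+oo[EFin \o (fun x => (sigmat x)^-1 - (sigma x)^-1)%R]%E.
  apply: opnormW_multiplication.
  - exact: Linfty_inv_diff hsigma hsigmat.
  - by move=> f /(wderiv_resolventB _ _ _ _ _ h0 hsigma hsigmat)[].
  - by move=> f /(wderiv_resolventB _ _ _ _ _ h0 hsigma hsigmat)[].
by split => //; rewrite E; exact: Linfty_inv_diff_bounds hsigma hsigmat.
Qed.
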